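(* There exist static, spherically symmetric, asymptotically flat solutions $(\mu,\lambda,f)$ of the massless Einstein–Vlasov system, with regular center and with compactly supported matter quantities $\varrho$, $p$, $p_T$. These solutions have the property that \[ \frac{4}{5}<\sup_{r\in[0,\infty)}\frac{2m(r)}{r}<\frac{8}{9}, \] where $m(r)=4\pi\int_0^r s^2\varrho(s)\,\mathrm ds$.
   Context: Units with $c=G=1$. A static spherically symmetric spacetime is described in Schwarzschild coordinates by the metric $g=-e^{2\mu(r)}\mathrm dt^2+e^{2\lambda(r)}\mathrm dr^2+r^2(\mathrm d\vartheta^2+\sin^2\vartheta\,\mathrm d\varphi^2)$, $r\in[0,\infty)$. The massless static Einstein–Vlasov system consists of the Einstein equations $e^{-2\lambda}(2r\lambda'-1)+1=8\pi r^2\varrho(r)$, $e^{-2\lambda}(2r\mu'+1)-1=8\pi r^2 p(r)$, together with the regular-center condition $\lambda(0)=0$, asymptotic flatness $\lim_{r\to\infty}\mu(r)=\lim_{r\to\infty}\lambda(r)=0$, and the static Vlasov equation for a particle density $f(x,v)\ge 0$, $x\in\mathbb R^3$, $v\in\mathbb R^3\setminus\{0\}$ (momenta of massless particles in an orthonormal frame, $|v|=\sqrt{\delta_{ab}v^av^b}$), spherically symmetric in the sense $f(Ax,Av)=f(x,v)$ for $A\in SO(3)$: $\frac{e^{\mu-\lambda}}{|v|}v^a\partial_{x^a}f-e^{\mu-\lambda}\frac{x^a}{r}|v|\mu'\partial_{v^a}f=0$, with $r=|x|$. The matter quantities are $\varrho(r)=\int f|v|\,\mathrm dv$, $p(r)=\int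 \frac{f}{|v|}\big(\frac{x\cdot v}{r}\big)^2\mathrm dv$, $p_T(r)=\frac12\int\big|\frac{x\times v}{r}\big|^2\frac{f}{|v|}\mathrm dv$ (integrals over $\mathbb R^3\setminus\{0\}$). $m(r)$ is the Hawking mass. *)

(* Defs.v *)
From HB Require Import structures.
From mathcomp Require Import all_boot all_order all_algebra.
From mathcomp Require Import all_classical all_reals all_analysis.
Import Order.TTheory GRing.Theory Num.Theory numFieldNormedType.Exports.
Local Open Scope ring_scope.
Local Open Scope classical_set_scope.

Set Implicit Arguments.
Unset Strict Implicit.
Unset Printing Implicit Defensive.

Notation R3 R := ((R * R) * R)%type.

Section EVDefs.
Variable R : realType.

Definition coord3 (x : R3 R) (a : 'I_3) : R :=
  match val a with 0%N => x.1.1 | 1%N => x.1.2 | _ => x.2 end.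

Definition ebasis (a : 'I_3) : R3 R :=
  match val a with 0%N => ((1, 0), 0) | 1%N => ((0, 1), 0) | _ => ((0, 0), 1) end.

Definition dot3 (x v : R3 R) : R := \sum_(a < 3) coord3 x a * coord3 v a.
Definition enorm3 (x : R3 R) : R := Num.sqrt (dot3 x x).
Definition cross3 (x v : R3 R) : R3 R :=
  ((x.1.2 * v.2 - x.2 * v.1.2, x.2 * v.1.1 - x.1.1 * v.2),
    x.1.1 * v.1.2 - x.1.2 * v.1.1).
Definition scale3 (c : R) (x : R3 R) : R3 R := ((c * x.1.1, c * x.1.2), c * x.2).

Definition SO3 (A : 'M[R]_3) : Prop := A^T *m A = 1%:M /\ \det A = 1.
Definition rot3 (A : 'M[R]_3) (x : R3 R) : R3 R :=
  ((\sum_(j < 3) A (inord 0) j * coord3 x j, \sum_(j < 3) A (inord 1) j * coord3 x j),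
    \sum_(j < 3) A (inord 2) j * coord3 x j).

Definition leb3 := (((@lebesgue_measure R) \x (@lebesgue_measure R)) \x (@lebesgue_measure R))%E.

Definition nz3 : set (R3 R) := [set v | v != 0].

Definition hawking_mass (rho : R -> R) (r : R) : \bar R :=
  ((4 * pi)%:E * \int[@lebesgue_measure R]_(s in `[0%R, r]) (s ^+ 2 * rho s)%:E)%E.

End EVDefs.

(* Main.v *)
Require Import Defs.
From HB Require Import structures.
From mathcomp Require Import all_boot all_order all_algebra.
From mathcomp Require Import all_classical all_reals all_analysis.
From mathcomp Require Import ring lra measurable_realfun.
Import Order.TTheory GRing.Theory Num.Theory numFieldNormedType.Exports.
Local Open Scope ring_scope.
Local Open Scope classical_set_scope.

(* A static flow preserves the energy E = e^mu |v| and the squared angular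
   momentum L = |x × v|^2, so f = A E (L - b0 E^2)_+^(3/2) e^(-2 L), cut off at
   |x| = R1, solves the Vlasov equation as long as L < b0 E^2 just outside R1.
   With q = 8 pi r^2 p and y = max(r^2 e^(-2 mu) / b0 - 1, 0), the momentum
   integrals are explicit:
     8 pi r^2 rho = C y^2 (y + 6) / ((1 + y)^2 r^2),
     q = C y^3 / ((1 + y)^2 r^2),
   and the Einstein equations become a planar ODE for y and s = e^(-lambda),
   started at r = 1 from y = 0, s = 1 (the interior r < 1 is flat).
   For large C the shell is thin and rho dominates p.  The function
   V = 3 s + (1 + q) / s starts at 4, never exceeds 4, and decreases at a bounded
   rate.  From V <= 4 one gets s > 1/3, that is 2m/r < 8/9, and smallness of y.
   As V stays close to 4, q is bounded below while s is between 0.4 and 0.9, so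
   the density makes s drop quickly below 0.4, after which y returns to 0 at some
   R1 < 1.01.  There q = 0 and V is nearly 4, so s is nearly 1/3 and 2m/r > 4/5;
   beyond R1 the metric is Schwarzschild. *)
Set Implicit Arguments.
Unset Strict Implicit.
Unset Printing Implicit Defensive.

(** Write w for the radial component of the momentum and T for its squared transverse part. Then L
    >= b0 E^2 reads w^2 <= y T, so y measures how far photons may deviate from tangential motion.
    The ansatz is tuned so that matter sees mu only through y: the factor E cancels a leftover e^mu,
    e^(-2 L) gives convergence through r and T alone, and the power 3/2 makes f differentiable at
    the edge while the integrals stay rational in y. The crux is that photons are trace-free, rho =
    p + 2 p_T. For this reason rho cancels in V', so V changes little over a thin shell however
    large rho is, and the state slides along the curve V = 4. With q = 0 that curve contains only s
    = 1, where the shell starts, and s = 1/3, the Buchdahl value 2m/r = 8/9. The cut-off is there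
    because r^2 e^(-2 mu) is unbounded, so the ansatz would put photons far out again. It does not
    spoil differentiability because L <= b0 E^2 holds on a whole interval from R1 to R2 = 3/2 R1. *)

Lemma geometric_cauchy (R : realType) (u : nat -> R) (M : R) :
  (forall n, `|u n.+1 - u n| <= M / 2 ^+ n) ->
  exists l, forall n, `|l - u n| <= 2 * M / 2 ^+ n.
Proof.
move=> uM.
(* The intervals [v n, w n] are nested, so the supremum of the left ends lies in all of them; this
   gives the limit together with its rate. *)
pose v n := u n - 2 * M / 2 ^+ n.
pose w n := u n + 2 * M / 2 ^+ n.
have M2 n : 2 * M / 2 ^+ n.+1 = M / 2 ^+ n by rewrite exprS; field; rewrite expf_neq0.
have M0 : 0 <= M by have := uM 0%N; rewrite expr0 divr1; exact: le_trans.
have hM n : 2 * M / 2 ^+ n = M / 2 ^+ n + M / 2 ^+ n by rewrite -mulrA -mulrDl -mulr2n mulr_natl mulrnAl.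
have vS n : v n <= v n.+1.
  rewrite /v M2 hM; have := uM n; rewrite ler_norml => /andP[]; lra.
have wS n : w n.+1 <= w n.
  rewrite /w M2 hM; have := uM n; rewrite ler_norml => /andP[]; lra.
have vw n m : v n <= w m.
  have vle : {homo v : a b / (a <= b)%N >-> a <= b} by apply: homo_leq => // ? ? ? ; exact: le_trans.
  have wle : {homo w : a b / (a <= b)%N >-> b <= a}.
    by apply: (homo_leq (r := fun a b => b <= a)) => // a b c ba ca; exact: le_trans ca ba.
  apply: (le_trans (vle _ _ (leq_maxl n m))); apply: le_trans (wle _ _ (leq_maxr n m)).
  rewrite /v /w; have : 0 <= 2 * M / 2 ^+ maxn n m by rewrite divr_ge0 ?mulr_ge0 ?exprn_ge0.
  lra.
have hs : has_sup (range v).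
  split; first by exists (v 0%N); exists 0%N.
  by exists (w 0%N) => _ [n _ <-].
exists (sup (range v)) => n; rewrite ler_norml; apply/andP; split.
  have : v n <= sup (range v) by apply: sup_upper_bound => //; exists n.
  rewrite /v; lra.
have : sup (range v) <= w n by apply: ge_sup; [exact: hs.1|move=> _ [m _ <-]].
rewrite /w; lra.
Qed.

(** * Picard iteration *)

Section primitive.
Variable R : realType.
Notation mu := (@lebesgue_measure R).
Variables (c : R) (g : R -> R).
Hypothesis cg : continuous g.

Let int (A x : R) := (\int[mu]_(t in `[A, x]) g t)%R.

Let gi A x : mu.-integrable `[A, x] (EFin \o g).
Proof.
apply: continuous_compact_integrable; first exact: segment_compact.
exact: continuous_subspaceT.
Qed.

Let intB A B x : A <= B -> B <= x -> int A x - int A B = int B x.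
Proof.
move=> AB Bx; rewrite /int Rintegral_itvB ?bnd_simp// Rintegral_itv_obnd_cbnd//.
by apply: integrableS (gi B x) => // y /=; rewrite !in_itv/= => /andP[/ltW -> ->].
Qed.

(** The signed integral from c to x, as a difference of integrals from a common base. The base lies
    strictly to the left of both points, so neither order of x and c needs a separate case. *)
Definition primitive (x : R) : R :=
  let A := Num.min x c - 1 in int A x - int A c.

Let primitiveE A x : A <= x -> A <= c -> primitive x = int A x - int A c.
Proof.
move=> Ax Ac; rewrite /primitive /=.
set B := Num.min x c - 1.
have Bx : B <= x by rewrite /B; have := ge_min x x c; rewrite lexx /=; lra.
have Bc : B <= c by rewrite /B; have := ge_min c x c; rewrite lexx orbT /=; lra.
have [AB|/ltW BA] := leP A B.
  rewrite -(intB AB Bx) -(intB AB Bc); ring.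
rewrite -(intB BA Ax) -(intB BA Ac); ring.
Qed.

Lemma primitive_base : primitive c = 0.
Proof. by rewrite /primitive subrr. Qed.

Lemma is_derive_primitive (x : R) : is_derive x 1 primitive (g x).
Proof.
pose A := Num.min x c - 2.
have Ax : A < x - 1 by rewrite /A; have := ge_min x x c; rewrite lexx /=; lra.
have Ac : A < c by rewrite /A; have := ge_min c x c; rewrite lexx orbT /=; lra.
have [d1 d2] : derivable (int A) x 1 /\ (int A)^`() x = g x.
  apply: (@continuous_FTC1_closed _ _ _ _ (x + 1)); [by lra|exact: gi|lra|exact: cg].
have dA : is_derive x 1 (int A) (g x) by apply: DeriveDef; [exact: d1|rewrite -d2 derive1E].
apply: (@near_eq_is_derive _ _ _ (fun y => int A y - int A c)); last first.
  by apply: is_derive_eq; rewrite subr0.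
near=> y; apply/esym/primitiveE; last exact: ltW.
by apply/ltW/(lt_trans Ax); near: y; apply: lt_nbhsr; lra.
Unshelve. all: by end_near. Qed.
End primitive.

Section comparison.
Variable R : realType.

Lemma is_derive_continuous (f df : R -> R) :
  (forall x : R, is_derive x 1 f (df x)) -> continuous f.
Proof.
by move=> h x; apply/differentiable_continuous/derivable1_diffP; have [] := h x.
Qed.

Lemma le_is_derive (f df : R -> R) a b : a <= b ->
  (forall x : R, a <= x <= b -> is_derive x 1 f (df x)) ->
  (forall x, a <= x <= b -> 0 <= df x) -> f a <= f b.
Proof.
move=> ab fd df0; have [||x xab fE] := @MVT_segment _ f df a b ab.
- by move=> x; rewrite in_itv /= => /andP[/ltW ax /ltW xb]; apply: fd; rewrite ax.
- by apply: derivable_within_continuous => x xab; have [] := fd x xab.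
by rewrite -subr_ge0 fE mulr_ge0 ?subr_ge0 ?df0.
Qed.

(** Both K / k e^(k (x - c)) - D and K / k e^(k (x - c)) + D are nondecreasing. Integrating the
    weight gains the factor 1 / k, the source of the contraction in the Picard scheme. *)
Lemma expweight_le (D dD : R -> R) (c K k t : R) : 0 < k -> 0 <= K -> c <= t ->
  D c = 0 -> (forall x : R, is_derive x 1 D (dD x)) ->
  (forall x, c <= x -> `|dD x| <= K * expR (k * (x - c))) ->
  `|D t| <= K / k * expR (k * (t - c)).
Proof.
move=> k0 K0 ct Dc dDD bd.
have key (e : R) : `|e| = 1 -> e * D t <= K / k * expR (k * (t - c)).
  move=> e1.
  pose h x := K / k * expR (k * (x - c)) - e * D x.
  have hd (x : R) : is_derive x 1 h (K * expR (k * (x - c)) - e * dD x).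
    have dx := dDD x.
    have dl : is_derive x 1 (fun x => k * (x - c)) k.
      by apply: is_derive_eq; rewrite subr0 /GRing.scale /= mulr1.
    have de : is_derive x 1 (fun x => expR (k * (x - c))) (expR (k * (x - c)) * k).
      exact: is_derive1_comp (is_derive_expR _) dl.
    by apply: is_derive_eq; rewrite /GRing.scale /=; field; rewrite gt_eqF.
  have : h c <= h t.
    apply: (le_is_derive ct (fun x _ => hd x)) => x /andP[cx _].
    rewrite subr_ge0; apply: le_trans (bd _ cx).
    by rewrite (le_trans (ler_norm _))// normrM e1 mul1r.
  rewrite /h Dc mulr0 subr0 subrr mulr0 expR0 mulr1.
  have : 0 <= K / k by rewrite divr_ge0// ltW.
  lra.
rewrite ler_norml; apply/andP; split.
  have := key (-1); rewrite normrN1 => /(_ erefl); lra.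
have := key 1; rewrite normr1 => /(_ erefl); lra.
Qed.

Lemma expweight_norm_le (D dD : R -> R) (c K k t : R) : 0 < k -> 0 <= K ->
  D c = 0 -> (forall x : R, is_derive x 1 D (dD x)) ->
  (forall x, `|dD x| <= K * expR (k * `|x - c|)) ->
  `|D t| <= K / k * expR (k * `|t - c|).
Proof.
move=> k0 K0 Dc dDD bd; have [ct|/ltW tc] := leP c t.
  rewrite (@ger0_norm _ (t - c)) ?subr_ge0//.
  apply: (@expweight_le D dD) => // x cx; have := bd x; by rewrite (@ger0_norm _ (x - c)) ?subr_ge0.
(* Reflection at c reduces t <= c to the forward estimate. *)
pose D' x := D (2 * c - x).
have -> : D t = D' (2 * c - t) by rewrite /D'; congr D; ring.
have -> : `|t - c| = (2 * c - t) - c by rewrite distrC ger0_norm ?subr_ge0//; ring.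
apply: (@expweight_le D' (fun x => - dD (2 * c - x))) => //.
- lra.
- by rewrite /D' -Dc; congr D; ring.
- move=> x; have dl : is_derive x 1 (fun x => 2 * c - x) (-1).
    by apply: is_derive_eq; rewrite /GRing.scale /=; ring.
  have hh := @is_derive1_comp _ D (fun x => 2 * c - x) x _ _ (dDD (2 * c - x)) dl.
  by apply: (is_derive_eq hh); rewrite mulrN1.
- move=> x cx; rewrite normrN; apply: (le_trans (bd _)).
  have -> : `|2 * c - x - c| = x - c; last by [].
  by rewrite distrC ger0_norm; [ring|lra].
Qed.
End comparison.

Section picard.
Variables (R : realType) (I : Type) (g : I -> R -> (I -> R) -> R).
Variables (L B c : R) (y0 : I -> R).
Hypothesis L0 : 0 < L.
Hypothesis gB : forall i t (u : I -> R), `|g i t u| <= B.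
Hypothesis gL : forall i t (u v : I -> R) (d : R), (forall j, `|u j - v j| <= d) ->
  `|g i t u - g i t v| <= L * d.
Hypothesis gC : forall i (y : I -> R -> R), (forall j, continuous (y j)) ->
  continuous (fun t => g i t (y ^~ t)).

Let iterate n : I -> R -> R :=
  iter n (fun y i t => y0 i + primitive c (fun t => g i t (y ^~ t)) t)
    (fun i _ => y0 i).

Let iterateS_derive (y : I -> R -> R) (i : I) (t : R) : (forall j, continuous (y j)) ->
  is_derive t 1 (fun t => y0 i + primitive c (fun t => g i t (y ^~ t)) t)
    (g i t (y ^~ t)).
Proof.
move=> cy; have dp := is_derive_primitive c (@gC i y cy) t.
rewrite -[X in is_derive _ _ _ X]add0r.
by apply: (@is_deriveD _ _ _ (fun=> y0 i)).
Qed.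

Let cst_cont (a : R) : continuous (fun _ : R => a).
Proof. by move=> t; exact: cvg_cst. Qed.

Let iterate_cont n j : continuous (iterate n j).
Proof.
elim: n j => [|n IH] j; first exact: cst_cont.
exact: is_derive_continuous (fun t => iterateS_derive j t IH).
Qed.

Let iterate_derive n (i : I) (t : R) :
  is_derive t 1 (iterate n.+1 i) (g i t (iterate n ^~ t)).
Proof. by apply: iterateS_derive => j; exact: iterate_cont. Qed.

(* Measured against the weight W, each Picard step contracts by the factor 1/2
   on the whole line. *)
Let k := 2 * L.
Let M := B / k.
Let W t := expR (k * `|t - c|).

Let k0 : 0 < k. Proof. by rewrite mulr_gt0. Qed.
Let W0 t : 0 < W t. Proof. exact: expR_gt0. Qed.

Let iterate_base n i : iterate n i c = y0 i.
Proof. by case: n => [//|n] /=; rewrite primitive_base addr0. Qed.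

Let iterate_step i : 0 <= B -> forall n t,
  `|iterate n.+1 i t - iterate n i t| <= M * W t / 2 ^+ n.
Proof.
move=> B0 n; elim: n i => [|n IH] i t.
  rewrite expr0 divr1.
  apply: (@expweight_norm_le _ (fun t => iterate 1 i t - iterate 0 i t) (fun t => g i t y0)) => //.
  - by rewrite !iterate_base subrr.
  - by move=> x; rewrite -[g i x y0]subr0; apply: is_deriveB; exact: (iterate_derive 0).
  - move=> x; apply: (le_trans (gB _ _ _)); rewrite ler_peMr// -expR0 ler_expR.
    by rewrite mulr_ge0// ltW.
have -> : M * W t / 2 ^+ n.+1 = (L * (M / 2 ^+ n)) / k * W t.
  by rewrite exprS /k; field; rewrite expf_neq0// gt_eqF.
apply: (@expweight_norm_le _ (fun t => iterate n.+2 i t - iterate n.+1 i t)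
  (fun t => g i t (iterate n.+1 ^~ t) - g i t (iterate n ^~ t))) => //.
- by rewrite mulr_ge0 ?(ltW L0)// !divr_ge0 ?exprn_ge0 ?(ltW k0).
- by rewrite !iterate_base subrr.
- by move=> x; apply: is_deriveB; exact: iterate_derive.
move=> x; rewrite -mulrA; apply: gL => j.
by rewrite mulrAC; exact: IH.
Qed.

Theorem picard_lindelof : exists y : I -> R -> R,
  forall i, y i c = y0 i /\ forall t : R, is_derive t 1 (y i) (g i t (y ^~ t)).
Proof.
have [noI|/existsNP[i0 _]] := pselect (forall i : I, False).
  by exists (fun _ _ => 0) => i; case: (noI i).
have B0 : 0 <= B by apply: le_trans (gB i0 c y0).
have /choice[y yP] : forall it : I * R, exists l, forall n,
    `|l - iterate n it.1 it.2| <= 2 * (M * W it.2) / 2 ^+ n.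
  by move=> [i t]; apply: geometric_cauchy => n; exact: iterate_step.
have yb i n t : `|y (i, t) - iterate n i t| <= 2 * (M * W t) / 2 ^+ n by exact: yP (i, t) n.
have small (K e : R) : 0 < e -> exists n, K / 2 ^+ n < e.
  move=> e0; exists (Num.trunc (K / e)).+1.
  rewrite ltr_pdivrMr ?exprn_gt0//.
  have : K / e < (Num.trunc (K / e)).+1%:R by exact: truncnS_gt.
  rewrite ltr_pdivrMr// => /lt_le_trans; apply.
  rewrite mulrC ler_wpM2l ?ltW// -natrX ltr_nat; exact: ltn_expl.
have cy (i : I) : continuous (fun t => y (i, t)).
  move=> t; apply/cvgrPdist_lt => e e0.
  (* K dominates the weighted error on the whole unit ball around t, so a single n serves all nearby
     s in the three-epsilon argument. *)
  pose K := 2 * (M * expR (k * (`|t - c| + 1))).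
  have [n nK] := small K (e / 3) (divr_gt0 e0 (ltr0n _ 3)).
  have KW s : `|t - s| < 1 -> 2 * (M * W s) / 2 ^+ n < e / 3.
    move=> ts; apply: le_lt_trans nK; rewrite ler_wpM2r ?invr_ge0 ?exprn_ge0//.
    rewrite ler_wpM2l// ler_wpM2l ?divr_ge0 ?(ltW k0)// ler_expR ler_wpM2l ?(ltW k0)//.
    have -> : s - c = (t - c) - (t - s) by ring.
    by rewrite (le_trans (ler_normB _ _))// lerD2l ltW.
  near=> s.
  have ts1 : `|t - s| < 1.
    by near: s; exists 1 => //=.
  have h1 := le_lt_trans (yb i n t) (KW t _).
  have h2 := le_lt_trans (yb i n s) (KW s ts1).
  have h3 : `|iterate n i t - iterate n i s| < e / 3.
    by near: s; have /cvgrPdist_lt := @iterate_cont n i t; apply; rewrite divr_gt0.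
  have := h1 _; rewrite subrr normr0 => /(_ ltr01) {}h1.
  move: h1 h2 h3; rewrite !ltr_norml => /andP[? ?] /andP[? ?] /andP[? ?].
  by apply/andP; split; lra.
(* One more Picard step applied to the pointwise limit. It is differentiable by construction, and
   the contraction estimate shows that it equals the limit. *)
pose Y i t := y0 i + primitive c (fun t => g i t (fun j => y (j, t))) t.
have dY (i : I) (t : R) : is_derive t 1 (Y i) (g i t (fun j => y (j, t))).
  exact: (@iterateS_derive (fun j t => y (j, t))).
have Yy i t : Y i t = y (i, t).
  apply/eqP; rewrite -subr_eq0 -normr_le0; apply/ler_addgt0Pr => e e0; rewrite add0r.
  have [n nK] := small (4 * (M * W t)) e e0.
  apply: ltW; apply: le_lt_trans nK.
  have h1 := yb i n.+1 t.
  have h2 : `|Y i t - iterate n.+1 i t| <= (L * (2 * M / 2 ^+ n)) / k * W t.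
    apply: (@expweight_norm_le _ (fun t => Y i t - iterate n.+1 i t)
      (fun t => g i t (fun j => y (j, t)) - g i t (iterate n ^~ t))) => //.
    - rewrite mulr_ge0 ?(ltW L0)// divr_ge0 ?exprn_ge0//.
      by rewrite mulr_ge0// divr_ge0 ?(ltW k0).
    - by rewrite iterate_base /Y primitive_base addr0 subrr.
    - by move=> x; apply: is_deriveB; exact: iterate_derive.
    move=> x; rewrite -mulrA; apply: gL => j; apply: le_trans (yb j n x) _.
    by rewrite -/(W x) le_eqVlt; apply/orP; left; apply/eqP; ring.
  rewrite exprS in h1.
  have e1 : (L * (2 * M / 2 ^+ n)) / k * W t = M * W t / 2 ^+ n.
    by rewrite /k; field; rewrite expf_neq0// gt_eqF.
  have e2 : 2 * (M * W t) / (2 * 2 ^+ n) = M * W t / 2 ^+ n.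
    by field; rewrite expf_neq0.
  have e3 : 4 * (M * W t) / 2 ^+ n = 4 * (M * W t / 2 ^+ n) by ring.
  have p0 : 0 <= M * W t / 2 ^+ n.
    by rewrite divr_ge0 ?exprn_ge0// mulr_ge0 ?divr_ge0// ltW.
  rewrite e3; rewrite e1 in h2; rewrite e2 in h1.
  move: h1 h2; rewrite !ler_norml => /andP[? ?] /andP[? ?].
  by apply/andP; split; lra.
exists Y => i; split; first by rewrite /Y primitive_base addr0.
move=> t; have -> : Y ^~ t = fun j => y (j, t) by apply/funext => j; exact: Yy.
exact: dY.
Unshelve. all: by end_near. Qed.
End picard.

(** * Crossings, barriers and growth at a point *)

Section real_lemmas.
Variable R : realType.
Implicit Types (f df : R -> R) (a b c x : R).

Lemma last_crossing f a b c : a <= b ->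
  (forall x, a <= x <= b -> {for x, continuous f}) -> f a <= c -> c < f b ->
  exists z, [/\ a <= z < b, f z = c & forall x, z < x <= b -> c < f x].
Proof.
move=> ab cf fa fb.
pose S := [set x | a <= x <= b /\ f x <= c].
have Sa : S a by split=> //; rewrite lexx.
have hS : has_sup S.
  by split; [exists a|exists b => x [/andP[_ ->]]].
have az : a <= sup S by exact: sup_upper_bound.
have zb : sup S <= b by apply: ge_sup; [exists a|move=> x [/andP[_ ->]]].
have after x : sup S < x <= b -> c < f x.
  move=> /andP[zx xb]; rewrite ltNge; apply/negP => fx.
  have : x <= sup S by apply: sup_upper_bound => //; split=> //; rewrite xb (le_trans az) ?ltW.
  by rewrite leNgt zx.
have nb e : 0 < e -> exists2 d, 0 < d & forall x, `|sup S - x| < d -> `|f (sup S) - f x| < e.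
  move=> e0; have /cvgrPdist_lt/(_ e e0)/nbhs_ballP[d d0 dP] := cf (sup S) (introT andP (conj az zb)).
  by exists d.
have fz : f (sup S) <= c.
  rewrite leNgt; apply/negP => cfz.
  have [|d d0 dP] := nb (f (sup S) - c); first by rewrite subr_gt0.
  have [x Sx xz] := sup_adherent d0 hS.
  have xz' : x <= sup S by exact: sup_upper_bound.
  have := dP x; rewrite ger0_norm ?subr_ge0// => /(_ _)/ltr_normlW.
  have : sup S - x < d by lra.
  by move=> -> /(_ erefl); have := Sx.2; lra.
have zb' : sup S < b.
  by rewrite lt_neqAle zb andbT; apply: contraTneq fb => <-; rewrite -leNgt.
exists (sup S); split=> //; first by rewrite az.
apply/eqP; rewrite eq_le fz /= leNgt; apply/negP => fzc.
have [|d d0 dP] := nb (c - f (sup S)); first by rewrite subr_gt0.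
pose x := Num.min b (sup S + d / 2).
have zx : sup S < x by rewrite lt_min zb' /=; lra.
have xb : x <= b by rewrite ge_min lexx.
have xd : x <= sup S + d / 2 by rewrite ge_min lexx orbT.
have := after x; rewrite zx xb => /(_ erefl).
have := dP x; rewrite distrC ger0_norm ?subr_ge0 ?(ltW zx)// => /(_ _).
have : x - sup S < d by lra.
move=> -> /(_ erefl); rewrite distrC => /ltr_normlW; lra.
Qed.

Lemma first_zero f a b : a <= b ->
  (forall x, a <= x <= b -> {for x, continuous f}) -> 0 < f a -> f b <= 0 ->
  exists z, [/\ a < z <= b, f z = 0 & forall x, a <= x < z -> 0 < f x].
Proof.
move=> ab cf fa fb.
have cg x : - b <= x <= - a -> {for x, continuous (fun x => f (- x))}.
  move=> /andP[bx xa]; apply: continuous_comp; first exact: opp_continuous.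
  by apply: cf; apply/andP; split; lra.
have [|||z [/andP[bz za] fz zP]] := @last_crossing (fun x => f (- x)) (- b) (- a) 0 _ cg; rewrite ?opprK ?lerN2//.
exists (- z); split=> //; first by apply/andP; split; lra.
by move=> x /andP[ax xz]; rewrite -[x]opprK; apply: zP; apply/andP; split; lra.
Qed.

(** The sign of f' is only required in the strip between c and c'. Right after its last crossing of
    c the function is, by continuity, still in the strip, and the mean value theorem keeps it from
    rising. *)
Lemma barrier_le f df a b c c' : c < c' ->
  (forall x, a <= x <= b -> is_derive x 1 f (df x)) -> f a <= c ->
  (forall x, a < x < b -> c < f x < c' -> df x <= 0) ->
  forall x, a <= x <= b -> f x <= c.
Proof.
move=> cc' fd fa h x /andP[ax xb]; rewrite leNgt; apply/negP => cfx.
have cf u : a <= u <= x -> {for u, continuous f}.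
  move=> /andP[au ux]; have uab : a <= u <= b by rewrite au (le_trans ux).
  by apply/differentiable_continuous/derivable1_diffP; have [] := fd u uab.
have [z [/andP[az zx] fz zP]] := last_crossing ax cf fa cfx.
have /cvgrPdist_lt/(_ (c' - c)) := cf z (introT andP (conj az (ltW zx))); rewrite subr_gt0 => /(_ cc')/nbhs_ballP[d /= d0 dP].
pose w := Num.min x (z + d / 2).
have zw : z < w by rewrite lt_min zx /=; lra.
have wx : w <= x by rewrite ge_min lexx.
have wd : w <= z + d / 2 by rewrite ge_min lexx orbT.
have [||u uzw fE] := @MVT _ f df z w zw.
- move=> u; rewrite in_itv /= => /andP[zu uw]; apply: fd; apply/andP; split; lra.
- apply: derivable_within_continuous => u; rewrite in_itv /= => /andP[zu uw].
  have uab : a <= u <= b by apply/andP; split; lra.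
  by have [] := fd u uab.
move: uzw; rewrite in_itv /= => /andP[zu uw].
have : c < f w by apply: zP; rewrite zw wx.
have : df u <= 0.
  apply: h; first by apply/andP; split; lra.
  apply/andP; split; first by apply: zP; rewrite zu /=; lra.
  have := dP u; rewrite /ball /= distrC ger0_norm; last lra.
  have : u - z < d by lra.
  move=> -> /(_ erefl); rewrite distrC => /ltr_normlW; lra.
have : df u * (w - z) <= 0 -> c < f w -> False by rewrite -fE fz; lra.
move=> hF du cw; apply: hF cw; rewrite mulr_le0_ge0 ?subr_ge0//; exact: ltW.
Qed.

(** The slope function of f at a is continuous at a, hence positive nearby; the product form treats
    both sides of a at once. *)
Lemma is_derive_growth f a (d : R) : is_derive a 1 f d -> 0 < d ->
  exists2 e, 0 < e & forall x, `|x - a| < e -> x != a -> 0 < (f x - f a) * (x - a).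
Proof.
move=> fd d0; have /is_derive1_caratheodory[g [fE cg ga]] := fd.
have /cvgrPdist_lt/(_ _ d0)/nbhs_ballP[e /= e0 eP] := cg.
exists e => // x xe xa; rewrite fE -mulrA mulr_gt0//; last first.
  by rewrite -expr2 exprn_even_gt0//= subr_eq0.
have := eP x; rewrite /ball /= distrC => /(_ xe); rewrite ga => /ltr_normlW; lra.
Qed.

Lemma is_derive1V f x (d : R) : f x != 0 -> is_derive x 1 f d ->
  is_derive x 1 (fun t => (f t)^-1) (- d / f x ^+ 2).
Proof.
move=> fx fd; have h := is_deriveV fx fd.
by apply: (is_derive_eq h); rewrite /GRing.scale /= mulrC mulrN mulNr.
Qed.
End real_lemmas.

(** * Admissible vector fields and planar systems *)

Section bounded_lipschitz.
Variable R : realType.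
Implicit Types g h : R -> (bool -> R) -> R.

(* Bounded, Lipschitz in u and continuous along continuous curves: the hypotheses
   of [picard_lindelof]. *)
Definition blc g := exists B L : R, [/\ 0 <= B, 0 <= L,
  (forall t u, `|g t u| <= B),
  (forall t (u v : bool -> R) (d : R), (forall j, `|u j - v j| <= d) ->
     `|g t u - g t v| <= L * d) &
  (forall y : bool -> R -> R, (forall j, continuous (y j)) ->
     continuous (fun t => g t (y ^~ t)))].

Lemma blc_cst (a : R) : blc (fun _ _ => a).
Proof.
exists `|a|, 0; split=> //.
- by move=> t u v d _; rewrite subrr normr0 mul0r.
- by move=> y _ t; exact: cvg_cst.
Qed.

Lemma blcD g h : blc g -> blc h -> blc (fun t u => g t u + h t u).
Proof.
move=> [B [L [B0 L0 gB gL gC]]] [B' [L' [B'0 L'0 hB hL hC]]].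
exists (B + B'), (L + L'); split; rewrite ?addr_ge0//.
- by move=> t u; rewrite (le_trans (ler_normD _ _))// lerD.
- move=> t u v d uv; rewrite opprD addrACA (le_trans (ler_normD _ _))// mulrDl lerD//.
    exact: gL.
  exact: hL.
- by move=> y cy t; apply: cvgD; [exact: gC|exact: hC].
Qed.

Lemma blcM g h : blc g -> blc h -> blc (fun t u => g t u * h t u).
Proof.
move=> [B [L [B0 L0 gB gL gC]]] [B' [L' [B'0 L'0 hB hL hC]]].
exists (B * B'), (L * B' + B * L'); split; rewrite ?addr_ge0 ?mulr_ge0//.
- by move=> t u; rewrite normrM ler_pM.
- move=> t u v d uv.
  have -> : g t u * h t u - g t v * h t v =
    (g t u - g t v) * h t u + g t v * (h t u - h t v) by ring.
  rewrite (le_trans (ler_normD _ _))// !normrM.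
  have -> : (L * B' + B * L') * d = (L * d) * B' + B * (L' * d) by ring.
  by rewrite lerD// ler_pM//; [exact: gL|exact: hL].
- by move=> y cy t; apply: cvgM; [exact: gC|exact: hC].
Qed.

Lemma blcN g : blc g -> blc (fun t u => - g t u).
Proof.
move=> bg; have := blcM (blc_cst (-1)) bg.
by congr (blc _); apply/funext => t; apply/funext => u; rewrite mulN1r.
Qed.

Lemma blcV g (m : R) : 0 < m -> (forall t u, m <= g t u) -> blc g ->
  blc (fun t u => (g t u)^-1).
Proof.
move=> m0 mg [B [L [B0 L0 gB gL gC]]].
have g0 t u : 0 < g t u by exact: lt_le_trans (mg t u).
have gi0 t u : 0 < (g t u)^-1 by rewrite invr_gt0.
have gim t u : (g t u)^-1 <= m^-1 by rewrite lef_pV2 ?posrE.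
exists m^-1, (L * (m^-1 * m^-1)); split; rewrite ?mulr_ge0 ?invr_ge0 ?(ltW m0)//.
- by move=> t u; rewrite gtr0_norm ?invr_gt0// lef_pV2.
- move=> t u v d uv.
  have -> : (g t u)^-1 - (g t v)^-1 = - (g t u - g t v) * ((g t u)^-1 * (g t v)^-1).
    by field; rewrite !gt_eqF.
  rewrite normrM normrN mulrAC; apply: ler_pM => //; first exact: gL.
  by rewrite normrM (gtr0_norm (gi0 t u)) (gtr0_norm (gi0 t v)) ler_pM// ltW.
- by move=> y cy t; apply: cvgV; [rewrite gt_eqF|exact: gC].
Qed.

Definition clip (a b x : R) : R := Num.min (Num.max x a) b.

Lemma clip_id a b x : a <= x <= b -> clip a b x = x.
Proof. by move=> /andP[ax xb]; rewrite /clip max_l// min_l. Qed.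

Lemma clip_itv a b x : a <= b -> a <= clip a b x <= b.
Proof. by move=> ab; rewrite /clip le_min ge_min lexx le_max lexx !orbT ab. Qed.

Lemma clip_lip a b x y : `|clip a b x - clip a b y| <= `|x - y|.
Proof.
have h1 := ler_norm (x - y); have := ler_norm (y - x); rewrite distrC => h2.
rewrite /clip; case: (leP x a) => ?; case: (leP y a) => ?;
rewrite /Num.min; do ?[case: ifPn; rewrite -?leNgt => ?];
  by rewrite ler_norml; apply/andP; split; lra.
Qed.

Lemma continuous_clip a b : continuous (clip a b).
Proof.
move=> x; apply/cvgrPdist_lt => e e0; exists e => //= y.
by rewrite /ball /=; apply: le_lt_trans; exact: clip_lip.
Qed.

Lemma blc_clip_time a b : a <= b -> blc (fun t _ => clip a b t).
Proof.
move=> ab; exists (`|a| + `|b|), 0; split=> //.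
- move=> t _; have /andP[? ?] := clip_itv t ab.
  rewrite ler_norml; apply/andP; split.
    have := ler_norm (- a); rewrite normrN; have := normr_ge0 b; lra.
  have := ler_norm b; have := normr_ge0 a; lra.
- by move=> t u v d _; rewrite subrr normr0 mul0r.
- by move=> y _; exact: continuous_clip.
Qed.

Lemma blc_clip_coord a b j : a <= b -> blc (fun _ u => clip a b (u j)).
Proof.
move=> ab; exists (`|a| + `|b|), 1; split=> //.
- move=> t u; have /andP[? ?] := clip_itv (u j) ab.
  rewrite ler_norml; apply/andP; split.
    have := ler_norm (- a); rewrite normrN; have := normr_ge0 b; lra.
  have := ler_norm b; have := normr_ge0 a; lra.
- by move=> t u v d uv; rewrite mul1r (le_trans (clip_lip _ _ _ _)).
- move=> y cy t; apply: (@continuous_comp _ _ _ (y j) (clip a b)); first exact: cy.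
  exact: continuous_clip.
Qed.

Lemma blc_ode (g : bool -> R -> (bool -> R) -> R) (c : R) (y0 : bool -> R) :
  (forall i, blc (g i)) ->
  exists y : bool -> R -> R, forall i, y i c = y0 i /\
    forall t : R, is_derive t 1 (y i) (g i t (y ^~ t)).
Proof.
move=> gb; have [B1 [L1 [B10 L10 gB1 gL1 gC1]]] := gb true.
have [B2 [L2 [B20 L20 gB2 gL2 gC2]]] := gb false.
(* The summand 1 makes the Lipschitz constant strictly positive. *)
apply: (@picard_lindelof R bool g (L1 + L2 + 1) (B1 + B2)).
- lra.
- by move=> [] t u; [have := gB1 t u|have := gB2 t u]; lra.
- move=> i t u v d uv.
  have d0 : 0 <= d by apply: le_trans (uv true).
  have p1 : 0 <= L1 * d by rewrite mulr_ge0.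
  have p2 : 0 <= L2 * d by rewrite mulr_ge0.
  by case: i; [have := gL1 t u v d uv|have := gL2 t u v d uv]; lra.
- by case.
Qed.
End bounded_lipschitz.

(** * The reduced Einstein equations *)

Section shell.
Variable R : realType.

Variable C : R.

(* [qhat] and [rhohat] are 8 pi r^2 p and 8 pi r^2 rho; [dy_rhs] and [ds_rhs] are
   the Einstein equations for y and s = e^(-lambda). *)
Definition qhat (y r : R) : R := C * y ^+ 3 / ((1 + y) ^+ 2 * r ^+ 2).
Definition rhohat (y r : R) : R := C * y ^+ 2 * (y + 6) / ((1 + y) ^+ 2 * r ^+ 2).
Definition dy_rhs (y s r : R) : R := (1 + y) / r * (3 - (1 + qhat y r) / s ^+ 2).
Definition ds_rhs (y s r : R) : R := (1 - s ^+ 2 - rhohat y r) / (2 * r * s).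

(** Since s^2 = 1 - 2m/r, this is (3 (1 - 2m/r) + 1 + 8 pi r^2 p) / sqrt(1 - 2m/r), a functional
    behind sharp Buchdahl-type bounds. *)
Definition buchdahl (y s : R -> R) (r : R) : R := 3 * s r + (1 + qhat (y r) r) / s r.
(** No [rhohat] occurs: its contributions cancel because (1 + y) times the y-derivative of [qhat]
    equals ([rhohat] + [qhat]) / 2. *)
Definition dbuchdahl (y s : R -> R) (r : R) : R :=
  (4 * s r ^+ 2 - 3 * s r ^+ 4 - (1 + qhat (y r) r) ^+ 2) / (2 * r * s r ^+ 3).

(* Clipping makes the vector field globally bounded and Lipschitz; the solution
   never reaches the clipping thresholds inside the shell. *)
Let cy (u : bool -> R) := clip 0 1 (u true).
Let cs (u : bool -> R) := clip 4^-1 1 (u false).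
Let cr (t : R) := clip 1 2 t.

Let rhs (i : bool) (t : R) (u : bool -> R) : R :=
  if i then dy_rhs (cy u) (cs u) (cr t) else ds_rhs (cy u) (cs u) (cr t).

Let blc_rhs i : blc (rhs i).
Proof.
have by_ : blc (fun _ u => cy u) by apply: blc_clip_coord.
have bs : blc (fun _ u => cs u) by apply: blc_clip_coord; lra.
have br : blc (fun t (_ : bool -> R) => cr t) by apply: blc_clip_time; lra.
have b1y : blc (fun _ u => (1 + cy u)^-1).
  apply: (@blcV _ _ 1) => //; last by apply: blcD => //; exact: blc_cst.
  by move=> t u; have /andP[] := @clip_itv R 0 1 (u true) ler01; rewrite /cy; lra.
have bsi : blc (fun _ u => (cs u)^-1).
  apply: (@blcV _ _ 4^-1) => //.
  by move=> t u; have /andP[] := @clip_itv R 4^-1 1 (u false) ltac:(lra).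
have bri : blc (fun t (_ : bool -> R) => (cr t)^-1).
  apply: (@blcV _ _ 1) => //.
  by move=> t u; have /andP[] := @clip_itv R 1 2 t ltac:(lra).
have bM := @blcM R; have bD := @blcD R; have bN := @blcN R; have bc := @blc_cst R.
have bq : blc (fun t u => qhat (cy u) (cr t)).
  have -> : (fun t u => qhat (cy u) (cr t)) =
    fun t u => C * (cy u * (cy u * cy u)) * ((1 + cy u)^-1 * (1 + cy u)^-1 * ((cr t)^-1 * (cr t)^-1)).
    apply/funext => t; apply/funext => u; rewrite /qhat invfM -!exprVn; ring.
  by apply: (bM); [apply: (bM) => //; apply: (bM) => //; apply: (bM)|apply: (bM) => //; apply: (bM)].
have brho : blc (fun t u => rhohat (cy u) (cr t)).
  have -> : (fun t u => rhohat (cy u) (cr t)) =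
    fun t u => C * (cy u * cy u * (cy u + 6)) * ((1 + cy u)^-1 * (1 + cy u)^-1 * ((cr t)^-1 * (cr t)^-1)).
    apply/funext => t; apply/funext => u; rewrite /rhohat invfM -!exprVn; ring.
  apply: (bM); last by apply: (bM) => //; apply: (bM).
  by apply: (bM) => //; apply: (bM); [apply: (bM)|apply: (bD)].
case: i.
  have -> : rhs true = fun t u => (1 + cy u) * (cr t)^-1 *
      (3 + - ((1 + qhat (cy u) (cr t)) * ((cs u)^-1 * (cs u)^-1))).
    by apply/funext => t; apply/funext => u; rewrite /rhs /dy_rhs -exprVn; ring.
  apply: (bM); first by apply: (bM) => //; apply: (bD).
  by apply: (bD) => //; apply: (bN); apply: (bM); [apply: (bD)|apply: (bM)].
have -> : rhs false = fun t u => (1 + - (cs u * cs u) + - rhohat (cy u) (cr t)) *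
    (2^-1 * ((cr t)^-1 * (cs u)^-1)).
  apply/funext => t; apply/funext => u; rewrite /rhs /ds_rhs !invfM expr2; ring.
apply: (bM); last by apply: (bM) => //; apply: (bM).
by apply: (bD); [apply: (bD) => //; apply: (bN); apply: (bM)|apply: (bN)].
Qed.

(** * The trajectory inside the shell *)

Section trajectory.
Variables y s : R -> R.
Hypothesis y1 : y 1 = 0.
Hypothesis s1 : s 1 = 1.
Hypothesis C0 : 0 < C.
Variable eta : R.
Hypothesis eta0 : 0 < eta.
Hypothesis eta_le : eta <= 1 / 1000.
Hypothesis C2 : 2 <= C * eta ^+ 3.
Hypothesis dy : forall t : R, is_derive t 1 y (dy_rhs (clip 0 1 (y t)) (clip 4^-1 1 (s t)) (clip 1 2 t)).
Hypothesis ds : forall t : R, is_derive t 1 s (ds_rhs (clip 0 1 (y t)) (clip 4^-1 1 (s t)) (clip 1 2 t)).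

Let rmax : R := 101 / 100.
Notation V := (buchdahl y s).
Notation dV := (dbuchdahl y s).

Let cony : continuous y. Proof. exact: is_derive_continuous dy. Qed.
Let cons : continuous s. Proof. exact: is_derive_continuous ds. Qed.

(** The bootstrap hypothesis: up to z the state lies in the clipping box, so for z <= [rmax] the
    unclipped equations hold there. [ok_all] recovers it from y >= 0 alone. *)
Let ok z := forall r, 1 <= r <= z -> 0 <= y r <= 1 /\ 4^-1 <= s r <= 1.

Let rhohat_ge0 (a r : R) : 0 <= a -> 0 <= rhohat a r.
Proof.
move=> a0; rewrite /rhohat.
rewrite divr_ge0 ?(mulr_ge0 (sqr_ge0 _) (sqr_ge0 _))//.
by rewrite mulr_ge0 ?(mulr_ge0 _ (sqr_ge0 _)) ?addr_ge0 ?(ltW C0).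
Qed.

Let qhat_ge0 (a r : R) : 0 <= a -> 0 <= qhat a r.
Proof.
move=> a0; rewrite /qhat.
rewrite divr_ge0 ?(mulr_ge0 (sqr_ge0 _) (sqr_ge0 _))//.
by rewrite mulr_ge0 ?exprn_ge0 ?(ltW C0).
Qed.

(** Above the level 1 the clipped value of s is exactly 1, so s' reduces to a negative multiple of
    [rhohat]. *)
Let s_le1 r : 1 <= r -> s r <= 1.
Proof.
move=> r1; apply: (@barrier_le _ s _ 1 r 1 2 _ (fun t _ => ds t)) => //; rewrite ?r1 ?lexx ?s1 ?ltr1n//.
move=> x _ /andP[sx _]; rewrite {2}/clip max_l; last lra.
rewrite min_r; last exact: ltW.
have /andP[a0 _] := clip_itv (y x) (@ler01 R).
have /andP[b0 _] := @clip_itv R 1 2 x ltac:(lra).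
rewrite /ds_rhs expr1n subrr sub0r mulr1 mulNr oppr_le0 divr_ge0 ?rhohat_ge0//.
by rewrite mulr_ge0//; lra.
Qed.

Let ok_dy z r : ok z -> z <= rmax -> 1 <= r <= z ->
  is_derive r 1 y (dy_rhs (y r) (s r) r).
Proof.
rewrite /rmax => okz zr rz; have [yr sr] := okz r rz; have := dy r.
by rewrite !clip_id//; apply/andP; split; lra.
Qed.

Let ok_ds z r : ok z -> z <= rmax -> 1 <= r <= z ->
  is_derive r 1 s (ds_rhs (y r) (s r) r).
Proof.
rewrite /rmax => okz zr rz; have [yr sr] := okz r rz; have := ds r.
by rewrite !clip_id//; apply/andP; split; lra.
Qed.

Let ok_dV z r : ok z -> z <= rmax -> 1 <= r <= z -> is_derive r 1 V (dV r).
Proof.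
move=> okz zr rz; have [/andP[y0 _] /andP[s0 _]] := okz r rz.
have dyr := ok_dy okz zr rz; have dsr := ok_ds okz zr rz.
have sn0 : s r != 0 by rewrite gt_eqF//; lra.
have rn0 : r != 0 by rewrite gt_eqF//; lra.
have yn0 : 1 + y r != 0 by rewrite gt_eqF//; lra.
have d1 := is_derive1V sn0 dsr.
have d2 : is_derive r 1 (fun t => (1 + y t) ^+ 2 * t ^+ 2)
   (2 * (1 + y r) * dy_rhs (y r) (s r) r * r ^+ 2 + (1 + y r) ^+ 2 * (2 * r)).
  by apply: is_derive_eq; rewrite /GRing.scale /=; ring.
have d3 := @is_derive1V _ (fun t => (1 + y t) ^+ 2 * t ^+ 2) r _ ltac:(by rewrite mulf_neq0 ?expf_neq0) d2.
have d4 : is_derive r 1 (fun t => C * y t ^+ 3) (C * (3 * y r ^+ 2 * dy_rhs (y r) (s r) r)).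
  by apply: is_derive_eq; rewrite /GRing.scale /=; ring.
rewrite /buchdahl /qhat; apply: is_derive_eq; rewrite /GRing.scale /=.
rewrite /dbuchdahl /dy_rhs /ds_rhs /qhat /rhohat.
field; rewrite rn0 sn0 yn0 /=; exact.
Qed.

Let V1 : V 1 = 4.
Proof. by rewrite /buchdahl /qhat y1 s1 expr0n /= mulr0 mul0r addr0 divr1; ring. Qed.

Let VE r : 4^-1 <= s r -> 1 + qhat (y r) r = V r * s r - 3 * s r ^+ 2.
Proof. by move=> sr; rewrite /buchdahl; field; rewrite gt_eqF//; lra. Qed.

(** If V > 4 then 1 + q > 4 s - 3 s^2 >= 0, and squaring bounds the numerator of V' above by -12 s^2
    (1 - s)^2. *)
Let V_le4 z : ok z -> z <= rmax -> forall r, 1 <= r <= z -> V r <= 4.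
Proof.
move=> okz zr.
have lt45 : 4 < 5 :> R by lra.
have V14 : V 1 <= 4 by rewrite V1.
apply: (barrier_le lt45 (fun x => ok_dV okz zr) V14).
move=> x /andP[x1 xz] /andP[V4 _].
have xz' : 1 <= x <= z by rewrite !ltW.
have [_ /andP[sx sx1]] := okz x xz'.
have s0 : 0 < s x by lra.
have : 4 * s x < V x * s x by rewrite ltr_pM2r.
have := VE sx; rewrite /dbuchdahl; set Q := 1 + qhat (y x) x => QE h.
have b1 : 0 <= 4 * s x - 3 * s x ^+ 2 by nra.
have b2 : (4 * s x - 3 * s x ^+ 2) ^+ 2 <= Q ^+ 2 by rewrite ler_sqr ?nnegrE; lra.
rewrite mulr_le0_ge0 ?invr_ge0//; last by rewrite !mulr_ge0 ?exprn_ge0; lra.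
have : 0 <= 12 * (s x * (1 - s x)) ^+ 2 by rewrite mulr_ge0 ?sqr_ge0.
move: b2; set S := s x; nra.
Qed.

Let q_le z r : ok z -> z <= rmax -> 1 <= r <= z ->
  qhat (y r) r <= 4 * s r - 3 * s r ^+ 2 - 1.
Proof.
move=> okz zr rz; have [_ /andP[sr _]] := okz r rz.
have := V_le4 okz zr rz; have := VE sr; have s0 : 0 < s r by lra.
have : V r <= 4 -> V r * s r <= 4 * s r by rewrite ler_pM2r.
lra.
Qed.

Let q_ge0 z r : ok z -> 1 <= r <= z -> 0 <= qhat (y r) r.
Proof. by move=> okz rz; apply: qhat_ge0; have [/andP[]] := okz r rz. Qed.

(** V <= 4 says q <= (1 - s) (3 s - 1), and q is nonnegative. *)
Let s_ge z r : ok z -> z <= rmax -> 1 <= r <= z -> 3^-1 <= s r.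
Proof.
move=> okz zr rz; have := q_le okz zr rz; have := q_ge0 okz rz.
have [_ /andP[sr sr1]] := okz r rz; nra.
Qed.

(** The bound (1 - s) (3 s - 1) for q is at most 1/3, its value at s = 2/3. With (1 + y)^2 <= 4 and
    r^2 <= 3/2 this gives C y^3 <= 2, the origin of the 2 in [C2]. *)
Let y_le z r : ok z -> z <= rmax -> 1 <= r <= z -> y r <= eta.
Proof.
move=> okz zr rz; have h := q_le okz zr rz.
have [/andP[y0 y1'] _] := okz r rz.
have q3 : qhat (y r) r <= 1 / 3 by have := sqr_ge0 (3 * s r - 2); nra.
have d0 : 0 < (1 + y r) ^+ 2 * r ^+ 2 by rewrite mulr_gt0 ?exprn_gt0//; lra.
move: q3; rewrite /qhat ler_pdivrMr//.
have r2 : r ^+ 2 <= 3 / 2 by move: zr; rewrite /rmax; nra.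
have p2 : (1 + y r) ^+ 2 <= 4 by nra.
have pr : (1 + y r) ^+ 2 * r ^+ 2 <= 4 * (3 / 2) by rewrite ler_pM ?sqr_ge0.
move=> hh; rewrite leNgt; apply/negP => yb.
have : eta ^+ 3 < y r ^+ 3 by rewrite ltrXn2r ?nnegrE ?(ltW eta0).
rewrite -(ltr_pM2l C0) ltNge => /negP; apply; apply: le_trans C2; apply: (le_trans hh).
rewrite -ler_pdivlMl ?divr_gt0//; apply: (le_trans pr); lra.
Qed.

(** The upper bound for q turns into V' >= -6 (1 - s)^2 / (r s), and the right side is at least -8,
    with equality for s = 1/3 and r = 1. *)
Let V_ge z : ok z -> z <= rmax -> forall r, 1 <= r <= z -> 4 - 8 * (r - 1) <= V r.
Proof.
move=> okz zr r /andP[r1 rz].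
have : V 1 + 8 * 1 <= V r + 8 * r; last by rewrite V1; lra.
apply: (@le_is_derive _ (fun t => V t + 8 * t) (fun t => dV t + 8) 1 r r1) => x /andP[x1 xr].
  have xz : 1 <= x <= z by rewrite x1 (le_trans xr).
  have dVx := ok_dV okz zr xz.
  by apply: is_derive_eq; rewrite /GRing.scale /=; ring.
have xz : 1 <= x <= z by rewrite x1 (le_trans xr).
have [_ /andP[sx sx1]] := okz x xz.
have s3 := s_ge okz zr xz; have qle := q_le okz zr xz; have q0 := q_ge0 okz xz.
rewrite -lerBlDr sub0r /dbuchdahl ler_pdivlMr; last by rewrite !mulr_gt0 ?exprn_gt0//; lra.
have b2 : (1 + qhat (y x) x) ^+ 2 <= (4 * s x - 3 * s x ^+ 2) ^+ 2 by rewrite ler_sqr ?nnegrE; lra.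
have b3 : 12 * (1 - s x) ^+ 2 <= 16 * s x by nra.
have b4 : 12 * (1 - s x) ^+ 2 * s x ^+ 2 <= 16 * s x * s x ^+ 2 by rewrite ler_wpM2r ?sqr_ge0.
have b5 : 0 <= (x - 1) * s x ^+ 3 by rewrite mulr_ge0 ?exprn_ge0; lra.
have b6 : 16 * s x * s x ^+ 2 <= 16 * x * s x ^+ 3.
  have -> : 16 * s x * s x ^+ 2 = 16 * s x ^+ 3 by ring.
  lra.
have -> : - 8 * (2 * x * s x ^+ 3) = - (16 * x * s x ^+ 3) by ring.
have e7 : (4 * s x - 3 * s x ^+ 2) ^+ 2 - 12 * (1 - s x) ^+ 2 * s x ^+ 2 = 4 * s x ^+ 2 - 3 * s x ^+ 4 by ring.
lra.
Qed.

(** Continuity argument: at the first point b where y = 1 or s = 1/4, [ok] b still holds, hence y <=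
    eta and s >= 1/3 there, a contradiction. *)
Let ok_all z : z <= rmax -> (forall r, 1 <= r <= z -> 0 <= y r) -> ok z.
Proof.
move=> zr y0 r /andP[r1 rz].
pose m t := Num.min (1 - y t) (s t - 4^-1).
have cm : continuous m.
  move=> t; apply: (@continuous_min R R (fun t => 1 - y t) (fun t => s t - 4^-1) t).
    by apply: cvgB; [exact: cvg_cst|exact: cony].
  by apply: cvgB; [exact: cons|exact: cvg_cst].
suff : 0 < m r.
  rewrite lt_min => /andP[h1 h2]; rewrite y0 ?r1// s_le1// andbT /=; split; lra.
rewrite ltNge; apply/negP => mr.
have m1 : 0 < m 1 by rewrite lt_min y1 s1; apply/andP; split; lra.
have [b [/andP[b1 br] mb bP]] := first_zero r1 (fun x _ => cm x) m1 mr.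
have okb : ok b.
  move=> t /andP[t1 tb].
  have : 0 <= m t.
    have [tb'|bt] := ltP t b; first by apply/ltW/bP; rewrite t1.
    by have -> : t = b; [lra|rewrite mb].
  rewrite le_min => /andP[h1 h2]; rewrite y0 ?t1 ?s_le1 ?(le_trans tb (le_trans br rz))// andbT /=; split; lra.
have br' : b <= rmax by rewrite (le_trans br)// (le_trans rz).
have bb : 1 <= b <= b by rewrite (ltW b1) lexx.
have := y_le okb br' bb; have := s_ge okb br' bb => h1 h2.
have := eta_le => h3.
have : 0 < m b by rewrite lt_min; apply/andP; split; lra.
by rewrite mb ltxx.
Qed.

Let ok_rho z r : ok z -> z <= rmax -> 1 <= r <= z -> 0 < y r ->
  6000 * qhat (y r) r <= rhohat (y r) r.
Proof.
move=> okz zr rz y0; have yl := y_le okz zr rz; have q0 := q_ge0 okz rz.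
have -> : rhohat (y r) r = qhat (y r) r * ((y r + 6) / y r).
  rewrite /rhohat /qhat; field.
  by rewrite !gt_eqF//; lra.
have eL := eta_le; rewrite mulrC ler_wpM2l// ler_pdivlMr//; lra.
Qed.

(** V >= 4 - 8/100 up to [rmax], so q >= 3.92 s - 3 s^2 - 1 >= 8/100 on this range of s and [rhohat]
    >= 480, while r s <= 1. The range ends at 91/100 to leave room above 9/10 for [barrier_le]. *)
Let ds_mid z r : ok z -> z <= rmax -> 1 <= r <= z ->
  2 / 5 < s r < 91 / 100 -> ds_rhs (y r) (s r) r <= - 200.
Proof.
have c1 : 101 / 100 * (91 / 100) <= 1 :> R by lra.
move=> okz zr rz /andP[s4 s9].
have s0 : 0 < s r by lra.
have r0 : 0 < r by lra.
have [/andP[y0 y1'] /andP[sr sr1]] := okz r rz.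
have Vg := V_ge okz zr rz.
have r1 : 1 <= r <= rmax by move: rz => /andP[-> rz]; rewrite (le_trans rz).
have VEr := VE sr.
have q8 : 8 / 100 <= qhat (y r) r.
  have : (4 - 8 * (r - 1)) * s r <= V r * s r by rewrite ler_pM2r//; lra.
  have : (4 - 8 / 100) * s r <= (4 - 8 * (r - 1)) * s r.
    by rewrite ler_pM2r; move: r1; rewrite /rmax; lra.
  have : 0 <= (s r - 2 / 5) * (91 / 100 - s r) by rewrite mulr_ge0//; lra.
  nra.
have yp : 0 < y r.
  rewrite lt_neqAle y0 andbT; apply/eqP => yE; move: q8.
  by rewrite -yE /qhat expr0n /= mulr0 mul0r; lra.
have rho := ok_rho okz zr rz yp.
rewrite /ds_rhs ler_pdivrMr ?mulr_gt0//.
have rs : r * s r <= 1.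
  have r2 : r <= 101 / 100 by case/andP: r1.
  apply: (le_trans (ler_pM (ltW r0) (ltW s0) r2 (ltW s9))).
  exact: c1.
have := sqr_ge0 (s r).
have -> : - 200 * (2 * r * s r) = - 400 * (r * s r) by ring.
lra.
Qed.

(** The bracket in y' equals 6 - V / s, which for V near 4 turns negative once s drops below about
    2/3. *)
Let dy_le z r : ok z -> z <= rmax -> 1 <= r <= z -> s r <= 2 / 5 ->
  dy_rhs (y r) (s r) r <= - 1.
Proof.
move=> okz zr rz s4; have [/andP[y0 _] /andP[sr sr1]] := okz r rz.
have Vg := V_ge okz zr rz.
have r1 : 1 <= r <= rmax by move: rz => /andP[-> rz]; rewrite (le_trans rz).
have r0 : 0 < r by lra.
have V3 : 39 / 10 <= V r by move: r1; rewrite /rmax; lra.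
have s0 : 0 < s r by lra.
have e1 : 3 - (1 + qhat (y r) r) / s r ^+ 2 = 6 - V r / s r.
  by rewrite VE//; field; rewrite gt_eqF.
have e2 : 39 / 4 <= V r / s r.
  rewrite ler_pdivlMr//; lra.
rewrite /dy_rhs e1.
have e3 : 1 / 2 <= (1 + y r) / r.
  by rewrite ler_pdivlMr//; move: r1; rewrite /rmax; lra.
have : (1 + y r) / r * (6 - V r / s r) <= (1 / 2) * (6 - V r / s r).
  by rewrite ler_wnM2r//; lra.
lra.
Qed.

Let dy_ge z r : ok z -> z <= rmax -> 1 <= r <= z -> 9 / 10 < s r ->
  1 <= dy_rhs (y r) (s r) r.
Proof.
move=> okz zr rz s9; have [/andP[y0 _] /andP[sr sr1]] := okz r rz.
have ql := q_le okz zr rz.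
have r1 : 1 <= r <= rmax by move: rz => /andP[-> rz]; rewrite (le_trans rz).
have r0 : 0 < r by lra.
have s0 : 0 < s r by lra.
have e1 : 15 / 10 <= 3 - (1 + qhat (y r) r) / s r ^+ 2.
  rewrite lerBrDr -lerBrDl ler_pdivrMr ?exprn_gt0//.
  have : 0 <= (s r - 9 / 10) * s r by rewrite mulr_ge0//; lra.
  nra.
have e3 : 9 / 10 <= (1 + y r) / r.
  by rewrite ler_pdivlMr//; move: r1; rewrite /rmax; lra.
rewrite /dy_rhs; apply: le_trans (ler_pM _ _ e3 e1); lra.
Qed.

Let y_neg : exists2 r, 1 <= r <= rmax & y r < 0.
Proof.
apply: contrapT => /forall2NP H.
have y0 r : 1 <= r <= rmax -> 0 <= y r.
  by move=> rr; case: (H r) => // /negP; rewrite -leNgt.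
have rr := lexx rmax.
have okr : ok rmax by apply: ok_all.
have eL := eta_le; have e0 := eta0; have rmE : rmax = 101 / 100 by [].
(* On an interval of length 2 eta, y' >= 1 would carry y to 2 eta, above its bound eta. *)
pose a2 := 1 + 2 * eta.
have a2l : a2 <= rmax by rewrite rmE /a2; lra.
have a21 : 1 <= a2 by rewrite /a2; lra.
have rm0 r : 1 <= r <= a2 -> 1 <= r <= rmax by move=> /andP[-> /le_trans ->].
have [ra ra12 sa] : exists2 r, 1 <= r <= a2 & s r <= 9 / 10.
  apply: contrapT => /forall2NP H1.
  have s9 r : 1 <= r <= a2 -> 9 / 10 < s r.
    by move=> r12; case: (H1 r) => // /negP; rewrite -ltNge.
  have : y 1 - 1 <= y a2 - a2.
    apply: (@le_is_derive _ (fun t => y t - t) (fun t => dy_rhs (y t) (s t) t - 1) _ _ a21) => x x12.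
      have dyx := ok_dy okr rr (rm0 x x12).
      by apply: is_derive_eq.
    by rewrite subr_ge0; apply: (dy_ge okr rr (rm0 x x12)); exact: s9.
  have a2i : 1 <= a2 <= rmax by rewrite a21.
  have := y_le okr rr a2i; rewrite y1 /a2; lra.
have [ra1 ra2] : 1 <= ra /\ ra <= 1 + 2 * eta by move/andP: ra12.
have lt1 : 9 / 10 < 91 / 100 :> R by lra.
have rm x : ra <= x <= rmax -> 1 <= x <= rmax.
  by move=> /andP[? ->]; rewrite andbT (le_trans ra1).
have sA x : ra <= x <= rmax -> s x <= 9 / 10.
  apply: (barrier_le lt1 (fun x h => ok_ds okr rr (rm x h)) sa) => {}x /andP[x1 x2] /andP[x3 x4].
  have xr : ra <= x <= rmax by rewrite !ltW.
  have x34 : 2 / 5 < s x < 91 / 100 by rewrite x4 andbT; lra.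
  by apply: le_trans (ds_mid okr rr (rm x xr) x34) _; lra.
(* At slope -200 this length lowers s by 1, more than the 9/10 available. *)
pose a3 := ra + 1 / 200.
have a31 : ra <= a3 by rewrite /a3; lra.
have a3l : a3 <= rmax by rewrite rmE /a3; lra.
have rm1 x : ra <= x <= a3 -> ra <= x <= rmax by move=> /andP[-> /le_trans ->].
have [rb rb12 sb] : exists2 r, ra <= r <= a3 & s r <= 2 / 5.
  apply: contrapT => /forall2NP H1.
  have s9 r : ra <= r <= a3 -> 2 / 5 < s r.
    by move=> r12; case: (H1 r) => // /negP; rewrite -ltNge.
  have : - s ra - 200 * ra <= - s a3 - 200 * a3.
    apply: (@le_is_derive _ (fun t => - s t - 200 * t) (fun t => - ds_rhs (y t) (s t) t - 200) _ _ a31) => x x12.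
      have dsx := ok_ds okr rr (rm x (rm1 x x12)).
      by apply: is_derive_eq; rewrite /GRing.scale /=; ring.
    have h34 : 2 / 5 < s x < 91 / 100.
      by rewrite s9//=; apply: le_lt_trans (sA x (rm1 x x12)) _; lra.
    have := ds_mid okr rr (rm x (rm1 x x12)) h34; lra.
  have := s9 a3; rewrite a31 lexx => /(_ erefl); rewrite /a3; lra.
have [rb1 rb2] : ra <= rb /\ rb <= ra + 1 / 200 by move/andP: rb12.
have lt2 : 2 / 5 < 91 / 100 :> R by lra.
have rm2 x : rb <= x <= rmax -> ra <= x <= rmax.
  by move=> /andP[? ->]; rewrite andbT (le_trans rb1).
have sB x : rb <= x <= rmax -> s x <= 2 / 5.
  apply: (barrier_le lt2 (fun x h => ok_ds okr rr (rm x (rm2 x h))) sb) => {}x /andP[x1 x2] x34.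
  have xr : rb <= x <= rmax by rewrite !ltW.
  by apply: le_trans (ds_mid okr rr (rm x (rm2 x xr)) x34) _; lra.
have rbr : rb <= rmax by rewrite rmE; lra.
(* At least 1/100 - 2/1000 - 1/200 = 3/1000 of the interval is left, longer than y <= eta can last
   at y' <= -1. *)
have : - y rb - rb <= - y rmax - rmax.
  apply: (@le_is_derive _ (fun t => - y t - t) (fun t => - dy_rhs (y t) (s t) t - 1) _ _ rbr) => x x12.
    have dyx := ok_dy okr rr (rm x (rm2 x x12)).
    by apply: is_derive_eq.
  by have := dy_le okr rr (rm x (rm2 x x12)) (sB x x12); lra.
have rbi : rb <= rb <= rmax by rewrite lexx.
have := y_le okr rr (rm _ (rm2 _ rbi)).
have rmi : 1 <= rmax <= rmax by rewrite lexx andbT rmE; lra.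
have := y0 rmax rmi; rewrite rmE; lra.
Qed.

Let dy1 : is_derive (1 : R) 1 y 2.
Proof.
have := dy 1; rewrite y1 s1 !clip_id ?lexx ?ler01//; try lra.
by rewrite /dy_rhs /qhat expr0n /= mulr0 mul0r !addr0 !expr1n !divr1 mul1r; congr (is_derive _ _ _ _); ring.
Qed.

(* If y were positive up to r = 101/100, then s would first fall below 9/10
   (otherwise y' >= 1 and y > eta), then below 2/5 (s' <= -200), and from then on
   y' <= -1 would exhaust y <= eta. *)
Theorem shell_trajectory : exists R1 : R,
  [/\ 1 < R1 <= 101 / 100,
      y R1 = 0,
      (forall r, 1 < r < R1 -> 0 < y r),
      (forall r, 1 <= r <= R1 -> [/\ 3^-1 < s r <= 1,
         is_derive r 1 y (dy_rhs (y r) (s r) r) &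
         is_derive r 1 s (ds_rhs (y r) (s r) r)]) &
      s R1 ^+ 2 < 1 / 5].
Proof.
(* As y vanishes at 1, the search for the next zero must start to the right of 1; y'(1) = 2 makes y
   positive there. *)
have [e e0 eP] := is_derive_growth dy1 (@ltr0Sn R 1).
have yp0 r : 1 < r < 1 + e -> 0 < y r.
  move=> /andP[r1 re]; have := eP r.
  have r10 : 0 < r - 1 by lra.
  rewrite gtr0_norm// y1 subr0 gt_eqF//.
  have -> : r - 1 < e by lra.
  by move=> /(_ erefl erefl); rewrite pmulr_lgt0.
have [rn /andP[rn1 rn2] yn] := y_neg.
have arn : 1 + e / 2 <= rn.
  rewrite leNgt; apply/negP => rna.
  have : rn != 1 by apply: contraTneq yn => ->; rewrite y1 ltxx.
  rewrite neq_lt => /orP[|rn1']; first lra.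
  have : 0 < y rn by apply: yp0; apply/andP; split; lra.
  lra.
have ya : 0 < y (1 + e / 2) by apply: yp0; apply/andP; split; lra.
have [R1 [/andP[aR1 R1n] yR1 yP]] := first_zero arn (fun x _ => @cony x) ya (ltW yn).
have R11 : 1 < R1 by lra.
have R1m : R1 <= rmax by exact: le_trans rn2.
have ypos r : 1 < r < R1 -> 0 < y r.
  move=> /andP[r1 rR]; have [ra|ra] := ltP r (1 + e / 2).
    by apply: yp0; apply/andP; split; lra.
  by apply: yP; rewrite ra.
have okR : ok R1.
  apply: ok_all => // r /andP[]; rewrite le_eqVlt => /predU1P[<-|r1].
    by rewrite y1.
  rewrite le_eqVlt => /predU1P[->|rR]; first by rewrite yR1.
  by apply/ltW/ypos; rewrite r1.
(* If s = 1/3 then q = 0, V = 4 and V' = -8 / r < 0, so V would exceed 4 just before r. *)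
have s_gt r : 1 <= r <= R1 -> 3^-1 < s r.
  move=> rR; rewrite lt_neqAle (s_ge okR R1m rR) andbT; apply/eqP => sE.
  have q0 := q_ge0 okR rR; have ql := q_le okR R1m rR.
  have qE : qhat (y r) r = 0 by move: ql; rewrite -sE; lra.
  have VE4 : V r = 4 by rewrite /buchdahl qE -sE; field.
  have r1 : 1 < r.
    case/andP: rR; rewrite le_eqVlt => /predU1P[rE|//] _.
    by move: sE; rewrite -rE s1; lra.
  have dVr := ok_dV okR R1m rR.
  have dneg : 0 < - dV r.
    have r0 : 0 < r by lra.
    rewrite /dbuchdahl qE -sE.
    have -> : - ((4 * 3^-1 ^+ 2 - 3 * 3^-1 ^+ 4 - (1 + 0) ^+ 2) / (2 * r * 3^-1 ^+ 3)) = 8 / r :> R.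
      by field; rewrite gt_eqF.
    by rewrite divr_gt0.
  have dN : is_derive r 1 (fun t => - V t) (- dV r) by exact: is_deriveN.
  have [d d0 dP] := is_derive_growth dN dneg.
  pose x := Num.max 1 (r - d / 2).
  have x1 : 1 <= x by rewrite le_max lexx.
  have xr : x < r by rewrite gt_max r1 /=; lra.
  have xd : r - d / 2 <= x by rewrite le_max lexx orbT.
  have xR : 1 <= x <= R1 by rewrite x1 (le_trans (ltW xr)); case/andP: rR.
  have := V_le4 okR R1m xR.
  have := dP x; rewrite distrC gtr0_norm ?subr_gt0// lt_eqF//.
  have -> : r - x < d by lra.
  move=> /(_ erefl erefl); rewrite VE4 nmulr_lgt0 ?subr_lt0//; lra.
have R1i : 1 <= R1 <= R1 by rewrite lexx ltW.
(* y falls to 0 at R1, so y' <= 0 and 3 s^2 <= 1, which rules out the end s near 1. Since q = 0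
   there, 3 s^2 + 1 >= 3.92 s, which fails for all s between 11/25 and 3/5. *)
have sR : s R1 ^+ 2 < 1 / 5.
  have s3 := s_gt _ R1i.
  have dyR := ok_dy okR R1m R1i.
  have dle : dy_rhs (y R1) (s R1) R1 <= 0.
    rewrite leNgt; apply/negP => dp.
    have [d d0 dP] := is_derive_growth dyR dp.
    pose x := Num.max (1 + e / 2) (R1 - d / 2).
    have xr : x < R1 by rewrite gt_max aR1 /=; lra.
    have x1 : 1 + e / 2 <= x by rewrite le_max lexx.
    have xd : R1 - d / 2 <= x by rewrite le_max lexx orbT.
    have := ypos x; rewrite xr andbT.
    have -> : 1 < x by lra.
    move=> /(_ erefl).
    have := dP x; rewrite distrC gtr0_norm ?subr_gt0// lt_eqF//.
    have -> : R1 - x < d by lra.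
    move=> /(_ erefl erefl); rewrite yR1 nmulr_lgt0 ?subr_lt0//; lra.
  have q0 : qhat (y R1) R1 = 0 by rewrite yR1 /qhat expr0n /= mulr0 mul0r.
  have s0 : 0 < s R1 by lra.
  have s23 : 3 * s R1 ^+ 2 <= 1.
    move: dle; rewrite /dy_rhs yR1 -yR1 q0 yR1 !addr0 pmulr_rle0 ?divr_gt0//; last lra.
    by rewrite subr_le0 ler_pdivlMr ?exprn_gt0.
  have Vg := V_ge okR R1m R1i.
  have V3 : 98 / 25 <= V R1 by move: R1m; rewrite /rmax; lra.
  have VsR : 98 / 25 * s R1 <= V R1 * s R1 by rewrite ler_pM2r.
  have s4 : 4^-1 <= s R1 by lra.
  have VEE := VE s4; rewrite q0 in VEE.
  rewrite ltNge; apply/negP => s447.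
  have sl : 11 / 25 <= s R1 by nra.
  have su : s R1 <= 3 / 5 by nra.
  have : 0 <= (s R1 - 11 / 25) * (3 / 5 - s R1) by rewrite mulr_ge0//; lra.
  nra.
exists R1; split=> //; first by rewrite R11.
move=> r rR; split; [|exact: ok_dy rR|exact: ok_ds rR].
by rewrite s_gt// s_le1//; case/andP: rR.
Qed.
End trajectory.

Theorem shell_solution (eta : R) : 0 < C -> 0 < eta -> eta <= 1 / 1000 ->
  2 <= C * eta ^+ 3 ->
  exists (y s : R -> R) (R1 : R),
  [/\ 1 < R1, [/\ y 1 = 0, s 1 = 1 & y R1 = 0],
      (forall r, 1 < r < R1 -> 0 < y r),
      (forall r, 1 <= r <= R1 -> [/\ 3^-1 < s r <= 1,
         is_derive r 1 y (dy_rhs (y r) (s r) r) &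
         is_derive r 1 s (ds_rhs (y r) (s r) r)]) &
      s R1 ^+ 2 < 1 / 5].
Proof.
move=> C0 eta0 etal C2.
have [z zP] := blc_ode 1 (fun i : bool => if i then 0 else 1) blc_rhs.
have [[y1 dy] [s1 ds]] := (zP true, zP false).
have [R1 [/andP[R11 _] yR1 ypos dys sR1]] := shell_trajectory y1 s1 C0 eta0 etal C2 dy ds.
by exists (z true), (z false), R1; split.
Qed.
End shell.

(** * The metric of the shell *)

Section glue.
Variable R : realType.
Implicit Types (f g df dg : R -> R) (a t : R).

Definition glue a f g t := if t <= a then f t else g t.

(** At the junction the two Caratheodory slope functions agree, so gluing them gives a continuous
    slope function. *)
Lemma is_derive_glue a f g df dg (t : R) :
  (t <= a -> is_derive t 1 f (df t)) -> (a <= t -> is_derive t 1 g (dg t)) ->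
  (t = a -> f a = g a /\ df a = dg a) ->
  is_derive t 1 (glue a f g) (glue a df dg t).
Proof.
move=> hf hg ha; have [ta|ta|ta] := ltgtP t a.
- rewrite {2}/glue ltW//; apply: near_eq_is_derive (hf (ltW ta)).
  near=> x; rewrite /glue ifT//; apply: ltW; near: x; exact: lt_nbhsl.
- rewrite {2}/glue leNgt ta /=; apply: near_eq_is_derive (hg (ltW ta)).
  near=> x; rewrite /glue ifF//; apply/negbTE; rewrite -ltNge; near: x; exact: lt_nbhsr.
have [fg dfg] := ha ta; rewrite {}ta in hf hg *.
have /is_derive1_caratheodory[p [pE cp pa]] := hf (lexx a).
have /is_derive1_caratheodory[p' [p'E cp' p'a]] := hg (lexx a).
apply/is_derive1_caratheodory; have gl (h k : R -> R) : glue a h k a = h a by rewrite /glue lexx.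
exists (glue a p p'); rewrite !gl; split=> //.
- move=> z; rewrite /glue; case: ifP => _; first exact: pE.
  by rewrite fg; exact: p'E.
apply/cvgrPdist_lt => e e0; near=> z; rewrite gl /glue; case: ifP => _.
  by near: z; move: cp => /cvgrPdist_lt; exact.
rewrite pa dfg -p'a; near: z; move: cp' => /cvgrPdist_lt; exact.
Unshelve. all: by end_near. Qed.

Lemma continuous_glue a f g (t : R) :
  (t <= a -> {for t, continuous f}) -> (a <= t -> {for t, continuous g}) ->
  (t = a -> f a = g a) -> {for t, continuous (glue a f g)}.
Proof.
move=> hf hg ha; have [ta|ta|ta] := ltgtP t a.
- apply/cvgrPdist_lt => e e0; near=> x.
  have xa : x < a by near: x; exact: lt_nbhsl.
  rewrite /glue !ltW//; near: x; have /cvgrPdist_lt := hf (ltW ta); exact.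
- apply/cvgrPdist_lt => e e0; near=> x.
  have xa : a < x by near: x; exact: lt_nbhsr.
  rewrite /glue !leNgt ta xa /=; near: x; have /cvgrPdist_lt := hg (ltW ta); exact.
have fg := ha ta; rewrite {}ta in hf hg *.
apply/cvgrPdist_lt => e e0; near=> x; rewrite {1}/glue lexx /glue; case: ifP => _.
  by near: x; have /cvgrPdist_lt := hf (lexx a); exact.
by rewrite fg; near: x; have /cvgrPdist_lt := hg (lexx a); exact.
Unshelve. all: by end_near. Qed.

Lemma is_derive_ln_comp f (t d : R) : is_derive t 1 f d -> 0 < f t ->
  is_derive t 1 (fun x => ln (f x)) (d / f t).
Proof.
move=> fd ft; rewrite mulrC.
have h := @is_derive1_comp _ (@ln R) f t _ _ (is_derive1_ln ft) fd.
exact: h.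
Qed.
End glue.

Section profile.
Variable R : realType.

(** The clause up to R2 ties the profile to the ansatz. On the gap from R1 to R2 it says r^2 e^(-2
    mu) <= b0, which makes the cut-off at R1 harmless. *)
Theorem photon_shell_metric : exists (C b0 R1 R2 : R) (Y mu lam : R -> R),
  [/\ [/\ 0 < C, 0 < b0, 0 < R1 & R1 < R2],
      [/\ continuous Y, (forall r, 0 <= Y r) & (forall r, r <= 1 \/ R1 <= r -> Y r = 0)],
      (forall r, 0 < r < R2 -> Num.max (r ^+ 2 * expR (- 2 * mu r) / b0 - 1) 0 = Y r),
      [/\ (forall r : R, derivable mu r 1 /\ derivable lam r 1),
          continuous mu, continuous lam &
          (forall r, 0 < r ->
            expR (- 2 * lam r) * (2 * r * derive1 lam r - 1) + 1 = rhohat C (Y r) r /\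
            expR (- 2 * lam r) * (2 * r * derive1 mu r + 1) - 1 = qhat C (Y r) r)] &
      [/\ lam 0 = 0, mu r @[r --> +oo] --> 0, lam r @[r --> +oo] --> 0,
         4 / 5 < 1 - expR (- 2 * lam R1) &
         exists2 B, B < 8 / 9 & forall r, 0 < r -> 1 - expR (- 2 * lam r) <= B]].
Proof.
have [eta eta0 etal] : exists2 eta : R, 0 < eta & eta <= 1 / 1000.
  by exists (1 / 1000); lra.
pose C : R := 2 / eta ^+ 3.
have C0 : 0 < C by rewrite divr_gt0 ?exprn_gt0.
have C2 : 2 <= C * eta ^+ 3 by rewrite divfK// expf_neq0// gt_eqF.
have [y [s [R1 [R11 [y1 s1 yR1] ypos dys sR1]]]] := shell_solution C0 eta0 etal C2.
move: C C0 {C2} dys => C C0 dys; clear eta eta0 etal.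
have R10 : 0 < R1 by lra.
have R1i : 1 <= R1 <= R1 by rewrite lexx ltW.
have sR0 : 0 < s R1 by have [/andP[]] := dys R1 R1i; lra.
have s0 r : 1 <= r <= R1 -> 0 < s r by move=> rr; have [/andP[]] := dys r rr; lra.
have y0 r : 1 <= r <= R1 -> 0 <= y r.
  move=> /andP[]; rewrite le_eqVlt => /predU1P[<-|r1]; first by rewrite y1.
  rewrite le_eqVlt => /predU1P[->|rR]; first by rewrite yR1.
  by apply/ltW/ypos; rewrite r1.
pose w1 := s R1 ^+ 2.
have w10 : 0 < w1 by rewrite exprn_gt0.
(* m2 is twice the total mass, read off from e^(-2 lambda) at R1. b0 is then forced: y = 0 at R1,
   where e^(2 mu) must have the Schwarzschild value w1 for mu to vanish at infinity. *)
pose m2 := R1 * (1 - w1).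
pose b0 := R1 ^+ 2 / w1.
have b00 : 0 < b0 by rewrite divr_gt0 ?exprn_gt0.
pose X r := 1 - m2 / r.
have X0 r : R1 <= r -> w1 <= X r.
  move=> rr; have r0 : 0 < r by lra.
  rewrite /X lerBrDr addrC -lerBrDr ler_pdivrMr// /m2.
  have w5 : w1 <= 1 by rewrite /w1; lra.
  by rewrite mulrC ler_wpM2l// subr_ge0.
have Xp r : R1 <= r -> 0 < X r by move=> /X0; lra.
have dX (r : R) : R1 <= r -> is_derive r 1 X (m2 / r ^+ 2).
  move=> rr; have r0 : 0 < r by lra.
  have d1 := is_derive1V (lt0r_neq0 r0) (is_derive_id r 1).
  by rewrite /X; apply: is_derive_eq; rewrite /GRing.scale /=; field; rewrite gt_eqF.
pose Y := glue 1 (fun=> 0) (glue R1 y (fun=> 0)).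
(* The middle piece is y = r^2 e^(-2 mu) / b0 - 1 solved for mu. *)
pose mu := glue 1 (fun=> - (ln b0 / 2)) (glue R1 (fun r => ln r - ln (b0 * (1 + y r)) / 2) (fun r => ln (X r) / 2)).
pose lam := glue 1 (fun=> 0) (glue R1 (fun r => - ln (s r)) (fun r => - (ln (X r) / 2))).
pose dmu := glue 1 (fun=> 0) (glue R1 (fun r => ((1 + qhat C (y r) r) / s r ^+ 2 - 1) / (2 * r)) (fun r => m2 / r ^+ 2 / X r / 2)).
pose dlam := glue 1 (fun=> 0) (glue R1 (fun r => - (ds_rhs C (y r) (s r) r / s r)) (fun r => - (m2 / r ^+ 2 / X r / 2))).
have XR1 : X R1 = w1 by rewrite /X /m2; field; rewrite gt_eqF.
have q0 r : qhat C 0 r = 0 by rewrite /qhat expr0n /= mulr0 mul0r.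
have rho0 r : rhohat C 0 r = 0 by rewrite /rhohat expr0n /= mulr0 !mul0r.
have lnw1 : ln w1 = 2 * ln (s R1) by rewrite /w1 lnXn// mulr_natl.
have lnb0 : ln b0 = 2 * ln R1 - 2 * ln (s R1).
  rewrite /b0 ln_div ?posrE ?exprn_gt0// lnw1.
  by rewrite lnXn//; ring.
have dmuP (r : R) : is_derive r 1 mu (dmu r).
  apply: is_derive_glue => [r1|_].
    apply: is_derive_glue => [rR|Rr|_].
    - have rr : 1 <= r <= R1 by rewrite r1.
      have [_ dy _] := dys r rr.
      have r0 : 0 < r by lra.
      have d1 := is_derive1_ln r0.
      have d2 : is_derive r 1 (fun r => b0 * (1 + y r)) (b0 * dy_rhs C (y r) (s r) r).
        by apply: is_derive_eq; rewrite /GRing.scale /=; ring.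
      have yr : 0 < 1 + y r by have := y0 r rr; lra.
      have byr : 0 < b0 * (1 + y r) by rewrite mulr_gt0.
      have d3 := is_derive_ln_comp d2 byr.
      apply: is_derive_eq; rewrite /GRing.scale /= /dy_rhs.
      by field; rewrite !gt_eqF// s0.
    - have d1 := is_derive_ln_comp (dX r Rr) (Xp r Rr).
      by apply: is_derive_eq; rewrite /GRing.scale /=; ring.
    - rewrite XR1 yR1 addr0 mulr1 lnb0 lnw1 q0; split; first by field.
      by rewrite addr0 -/w1 /m2; field; rewrite !gt_eqF.
  rewrite /glue ltW// y1 s1 q0 ln1 !addr0 mulr1 sub0r expr1n; split=> //.
  by field.
have dlamP (r : R) : is_derive r 1 lam (dlam r).
  apply: is_derive_glue => [r1|_].
    apply: is_derive_glue => [rR|Rr|_].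
    - have rr : 1 <= r <= R1 by rewrite r1.
      have [_ _ ds] := dys r rr.
      have d1 := is_derive_ln_comp ds (s0 r rr).
      by apply: is_derive_eq.
    - have d1 := is_derive_ln_comp (dX r Rr) (Xp r Rr).
      by apply: is_derive_eq; rewrite /GRing.scale /=; ring.
    - rewrite XR1 yR1 lnw1; split; first by field.
      by rewrite /ds_rhs rho0 /m2 /w1; field; rewrite !gt_eqF.
  rewrite /glue ltW// y1 s1 ln1 oppr0; split=> //.
  by rewrite /ds_rhs rho0 expr1n subrr subr0 !mul0r oppr0.
have elam1 r : r <= 1 -> expR (- 2 * lam r) = 1.
  by move=> r1; rewrite /lam /glue r1 mulr0 expR0.
have elam2 r : 1 <= r <= R1 -> expR (- 2 * lam r) = s r ^+ 2.
  move=> rr; have sr := s0 r rr; case/andP: (rr) => r1 rR.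
  rewrite -{1}(lnK sr) -expRM_natl /lam /glue rR; case: ifP => [r1'|_].
    have -> : r = 1 by lra.
    by rewrite s1 ln1 !mulr0.
  by congr expR; ring.
have elam3 r : R1 <= r -> expR (- 2 * lam r) = X r.
  move=> rr; rewrite -{1}(lnK (Xp r rr)); congr expR; rewrite /lam /glue.
  rewrite ifF; last by apply/negbTE; rewrite -ltNge; lra.
  case: ifP => [rR|_]; last by field.
  have -> : r = R1 by lra.
  by rewrite XR1 lnw1; ring.

have cmu : continuous mu by exact: is_derive_continuous dmuP.
have clam : continuous lam by exact: is_derive_continuous dlamP.
have lamR1 : expR (- 2 * lam R1) = w1 by rewrite elam2.
have limX : ln (X r) / 2 @[r --> +oo] --> (0 : R).
  have X1 : X r @[r --> +oo] --> (1 : R).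
    rewrite /X -[Z in _ --> Z]subr0; apply: cvgB; first exact: cvg_cst.
    rewrite -(mulr0 m2); apply: cvgM; first exact: cvg_cst.
    by apply/gtr0_cvgV0; [near=> r; near: r; exact: nbhs_pinfty_gt|exact: cvg_id].
  have lX : (@ln R \o X) r @[r --> +oo] --> ln (1 : R).
    by apply: continuous_cvg X1; exact: continuous_ln.
  by rewrite -(mul0r (2^-1 : R)) -[in X in _ --> X](@ln1 R); apply: cvgM lX (cvg_cst _).
have big : \forall r \near +oo, R1 < r by apply: nbhs_pinfty_gt; exact: num_real.
exists C, b0, R1, (3 / 2 * R1), Y, mu, lam; split.
- by split=> //; lra.
- split.
  + move=> r; apply: continuous_glue => [_|r1|_]; first exact: cvg_cst.
      apply: continuous_glue => [rR|_|//]; last exact: cvg_cst.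
      have rr : 1 <= r <= R1 by rewrite r1.
      have [_ dy _] := dys r rr.
      by apply/differentiable_continuous/derivable1_diffP; have [] := dy.
    by rewrite /glue ltW// y1.
  + move=> r; rewrite /Y /glue; have [//|r1] := leP r 1; have [rR|//] := leP r R1.
    by apply: y0; rewrite rR ltW.
  + move=> r; rewrite /Y /glue; have [//|r1] := leP r 1; have [rR|//] := leP r R1.
    case=> [r1'|Rr]; first lra.
    have -> : r = R1 by lra.
    exact: yR1.
- move=> r /andP[r0 rR2].
  have [r1|r1] := leP r 1.
    have -> : expR (- 2 * mu r) = b0.
      rewrite /mu /glue r1 -{2}(lnK b00); congr expR; by [field|].
    rewrite (mulfK (lt0r_neq0 b00)) /Y /glue r1 max_r// subr_le0.
    by rewrite expr_le1// ltW.
  have [rR|rR] := leP r R1.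
    have rr : 1 <= r <= R1 by rewrite ltW.
    have yr := y0 r rr.
    have byr : 0 < b0 * (1 + y r) by rewrite mulr_gt0//; lra.
    have -> : expR (- 2 * mu r) = b0 * (1 + y r) / r ^+ 2.
      rewrite /mu /glue leNgt r1 /= rR.
      have -> : - 2 * (ln r - ln (b0 * (1 + y r)) / 2) = ln (b0 * (1 + y r)) - 2 * ln r by field.
      by rewrite expRD lnK// expRN expRM_natl lnK.
    rewrite /Y /glue leNgt r1 /= rR.
    have -> : r ^+ 2 * (b0 * (1 + y r) / r ^+ 2) / b0 - 1 = y r by field; rewrite !gt_eqF.
    by rewrite max_l.
  have Rr := ltW rR; have Xr := Xp r Rr.
  have -> : expR (- 2 * mu r) = (X r)^-1.
    rewrite /mu /glue leNgt r1 /= leNgt rR /= -{2}(lnK Xr) -expRN; congr expR; by [field|].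
  rewrite /Y /glue leNgt r1 /= leNgt rR /= max_r// subr_le0 /b0.
  have -> : r ^+ 2 / X r / (R1 ^+ 2 / w1) = r ^+ 2 * w1 / (R1 ^+ 2 * X r).
    by field; rewrite !gt_eqF.
  rewrite ler_pdivrMr ?mul1r ?mulr_gt0 ?exprn_gt0// /X.
  have -> : R1 ^+ 2 * (1 - m2 / r) = R1 ^+ 2 * (r - m2) / r by field; rewrite gt_eqF.
  rewrite ler_pdivlMr// -subr_ge0 /m2.
  have -> : R1 ^+ 2 * (r - R1 * (1 - w1)) - r ^+ 2 * w1 * r =
    (r - R1) * (R1 ^+ 2 - w1 * (r ^+ 2 + r * R1 + R1 ^+ 2)) by ring.
  apply: mulr_ge0; first lra.
  (* For r <= 3/2 R1 the left side is at most 9/4 + 3/2 + 1 <= 5 times R1^2, which is matched to w1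
     < 1/5. *)
  have r2 : r ^+ 2 + r * R1 + R1 ^+ 2 <= 5 * R1 ^+ 2 by nra.
  have : w1 * (r ^+ 2 + r * R1 + R1 ^+ 2) <= w1 * (5 * R1 ^+ 2) by rewrite ler_pM2l.
  have : w1 * R1 ^+ 2 <= 1 / 5 * R1 ^+ 2 by rewrite ler_pM2r ?exprn_gt0// ltW.
  lra.
- split=> //.
  move=> r r0.
  have -> : derive1 mu r = dmu r by rewrite derive1E; have [] := dmuP r.
  have -> : derive1 lam r = dlam r by rewrite derive1E; have [] := dlamP r.
  have [r1|r1] := leP r 1.
    rewrite elam1// /dmu /dlam /Y /glue r1 rho0 q0; split; ring.
  have [rR|rR] := leP r R1.
    have rr : 1 <= r <= R1 by rewrite ltW.
    have sr := s0 r rr; have yr : 0 < 1 + y r by have := y0 r rr; lra.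
    rewrite elam2// /dmu /dlam /Y /glue leNgt r1 /= rR /ds_rhs; split.
      by field; rewrite !gt_eqF.
    by field; rewrite !gt_eqF.
  have Rr := ltW rR; have Xr := Xp r Rr.
  rewrite elam3// /dmu /dlam /Y /glue leNgt r1 /= leNgt rR /= rho0 q0.
  have mE : m2 = r * (1 - X r) by rewrite /X; field; rewrite gt_eqF.
  by rewrite mE; split; field; rewrite !gt_eqF.
- split.
  + by rewrite /lam /glue ler01.
  + apply: cvg_trans limX; apply: near_eq_cvg; near=> r.
    have rR : R1 < r by near: r.
    by rewrite /mu /glue !leNgt rR (lt_trans R11 rR).
  + rewrite -oppr0; apply: cvg_trans (cvgN limX); apply: near_eq_cvg; near=> r.
    have rR : R1 < r by near: r.
    by rewrite /lam /glue !leNgt rR (lt_trans R11 rR).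
  + by rewrite lamR1 /w1; lra.
  (* The strict bound must survive the supremum over r, so it is taken at the minimum of s on the
     compact shell. *)
  have cs : {within `[1, R1], continuous s}.
    apply: derivable_within_continuous => x; rewrite in_itv /= => xR.
    by have [_ _ []] := dys x xR.
  have [c cR cP] := EVT_min (ltW R11) cs.
  rewrite in_itv /= in cR; have [/andP[sc _] _ _] := dys c cR.
  have cPs r : 1 <= r <= R1 -> s c ^+ 2 <= s r ^+ 2.
    move=> rr; rewrite ler_sqr ?nnegrE ?(ltW (s0 _ _))//.
    by apply: cP; rewrite in_itv.
  exists (1 - s c ^+ 2).
    have : (3^-1 : R) ^+ 2 < s c ^+ 2 by rewrite ltr_sqr ?nnegrE//; lra.
    lra.
  move=> r r0; have [r1|r1] := leP r 1.
    rewrite elam1// subrr subr_ge0 -(expr1n _ 2) -s1; apply: cPs; rewrite lexx ltW//.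
  have [rR|rR] := leP r R1.
    have rr : 1 <= r <= R1 by rewrite ltW.
    by rewrite elam2// lerD2l lerN2; exact: cPs.
  rewrite elam3 ?(ltW rR)// lerD2l lerN2; apply: le_trans (X0 r (ltW rR)).
  exact: cPs.
Unshelve. all: by end_near. Qed.
End profile.

(** * Lebesgue measure on R^3 *)

Section affine_change.
Variable R : realType.
Notation mu := (@lebesgue_measure R).
Variables (k c : R).
Hypothesis k0 : k != 0.

Let phi (x : measurableTypeR R) : measurableTypeR R := k * x + c.

Let mphi : measurable_fun setT phi.
Proof.
apply: measurable_funD => //; apply: measurable_funM => //; exact: measurable_cst.
Qed.

Let nu : {measure set (measurableTypeR R) -> \bar R}.
Proof. unshelve refine (mscale (`|k|%:nng) (pushforward mu phi)); exact: mphi. Defined.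

(** By uniqueness only half-open intervals matter. A negative k reverses them and moves the closed
    end, hence the two cases. *)
Let lebesgue_affine (A : set (measurableTypeR R)) : measurable A ->
  mu A = nu A.
Proof.
move=> mA; apply: lebesgue_measure_unique => //= _ [[a b]] _ <-.
rewrite /nu /mscale /=.
change (mu `]a, b] = (`|k|%:E * mu (phi @^-1` `]a, b]))%E).
have k'0 : `|k| != 0 by rewrite normr_eq0.
have [kp|kn|kE] := ltgtP k 0; last by have := k0; rewrite kE eqxx.
  have -> : phi @^-1` `]a, b] = `[(b - c) / k, (a - c) / k[%classic.
    apply/seteqP; split => x /=; rewrite !in_itv /= /phi => /andP[h1 h2].
      by rewrite ler_ndivrMr// ltr_ndivlMr//; apply/andP; split; lra.
    move: h1 h2; rewrite ler_ndivrMr// ltr_ndivlMr// => h1 h2.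
    by apply/andP; split; lra.
  rewrite !lebesgue_measure_itv /= !lte_fin ltr_ndivlMr// divfK ?lt_eqF// ltrD2r.
  case: ifPn => ab; last by rewrite mule0.
  rewrite -!EFinB -EFinM ltr0_norm//; congr EFin; field.
  by rewrite lt_eqF.
have -> : phi @^-1` `]a, b] = `](a - c) / k, (b - c) / k]%classic.
  apply/seteqP; split => x /=; rewrite !in_itv /= /phi => /andP[h1 h2].
    by rewrite ler_pdivlMr// ltr_pdivrMr//; apply/andP; split; lra.
  move: h1 h2; rewrite ler_pdivlMr// ltr_pdivrMr// => h1 h2.
  by apply/andP; split; lra.
rewrite !lebesgue_measure_itv /= !lte_fin ltr_pdivlMr// divfK ?gt_eqF// ltrD2r.
case: ifPn => ab; last by rewrite mule0.
rewrite -!EFinB -EFinM gtr0_norm//; congr EFin; field.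
by rewrite gt_eqF.
Qed.

Lemma integral_affine (f : R -> \bar R) : measurable_fun setT f ->
  (forall x, 0 <= f x)%E ->
  (\int[mu]_x f x = `|k|%:E * \int[mu]_x f (k * x + c)%R)%E.
Proof.
move=> mf f0.
transitivity (\int[nu]_x f x)%E.
  by apply: eq_measure_integral => A mA _; exact: lebesgue_affine.
rewrite /nu ge0_integral_mscale//=; congr (_ * _)%E.
by rewrite ge0_integral_pushforward//= preimage_setT.
Qed.
End affine_change.

Section tonelli3.
Variable R : realType.
Notation mu := (@lebesgue_measure R).
Local Open Scope ereal_scope.

(** The inner product measure as a sigma-finite measure of its own, so that [leb3] is a product of
    two factors to which Tonelli applies. *)
Definition leb2 : set (measurableTypeR R * measurableTypeR R) -> \bar R := mu \x mu.

HB.instance Definition _ := Measure.on leb2.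

Let leb2_sigma_finite : sigma_finite setT leb2.
Proof.
pose I (n : nat) : set (measurableTypeR R) := `[(- n%:R)%R, n%:R%R]%classic.
have mI n : measurable (I n) by exact: measurable_itv.
exists (fun n => I n `*` I n).
  apply/esym/seteqP; split=> // -[x y] _.
  exists (Num.trunc (`|x| + `|y|)%R).+1 => //.
  have h := truncnS_gt (`|x| + `|y|)%R.
  split; rewrite /I /= in_itv /= -ler_norml; apply: le_trans (ltW h).
    by rewrite lerDl.
  by rewrite lerDr.
move=> n; split; first exact: measurableX.
have -> : leb2 (I n `*` I n) = mu (I n) * mu (I n) by exact: product_measure1E.
rewrite /I lebesgue_measure_itv /=.
case: ifP => _; last by rewrite mule0 ltry.
by rewrite -EFinB -EFinM ltry.
Qed.

HB.instance Definition _ := Measure_isSigmaFinite.Build _ _ _ leb2 leb2_sigma_finite.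

Implicit Type f : R3 R -> \bar R.

Lemma leb3_tonelli123 f : measurable_fun setT f -> (forall v, 0 <= f v) ->
  \int[@leb3 R]_v f v = \int[mu]_a \int[mu]_b \int[mu]_c f ((a, b), c).
Proof.
move=> mf f0.
rewrite (_ : \int[@leb3 R]_v f v = \int[leb2 \x mu]_v f v)//.
rewrite (@fubini_tonelli1 _ _ _ _ R leb2 mu f mf f0).
rewrite (@fubini_tonelli1 _ _ _ _ R mu mu (fubini_F mu f))//.
  exact: (@measurable_fun_fubini_tonelli_F _ _ _ _ R mu f mf f0).
by move=> x; rewrite /fubini_F; apply: integral_ge0 => y _; exact: f0.
Qed.

Lemma leb3_tonelli312 f : measurable_fun setT f -> (forall v, 0 <= f v) ->
  \int[@leb3 R]_v f v = \int[mu]_c \int[mu]_a \int[mu]_b f ((a, b), c).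
Proof.
move=> mf f0.
rewrite (_ : \int[@leb3 R]_v f v = \int[leb2 \x mu]_v f v)//.
rewrite (@fubini_tonelli2 _ _ _ _ R leb2 mu f mf f0).
apply: eq_integral => c _.
rewrite /fubini_G (@fubini_tonelli1 _ _ _ _ R mu mu (fun v => f (v, c)))//.
exact: measurable_fun_pair1.
Qed.
End tonelli3.

(** * Rotation invariance of momentum integrals *)

Section rotation.
Variable R : realType.
Notation mu := (@lebesgue_measure R).
Implicit Type G : R * R -> \bar R.

Lemma dot3E (x v : R3 R) : dot3 x v = x.1.1 * v.1.1 + x.1.2 * v.1.2 + x.2 * v.2.
Proof. by rewrite /dot3 !big_ord_recl big_ord0 /coord3 /= addr0 addrA. Qed.

(** A one-variable affine substitution on each side, together with Tonelli, replaces the planar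
    change of variables: both sides acquire the factor |k| and, as rho^2 = p^2 + q^2, the same
    quadratic form. *)
Lemma rotate2 G (p q rho : R) : measurable_fun setT G -> (forall z, 0 <= G z)%E ->
  0 <= rho -> rho ^+ 2 = p ^+ 2 + q ^+ 2 ->
  (\int[mu]_a \int[mu]_b G (a ^+ 2 + b ^+ 2, p * a + q * b)%R =
   \int[mu]_a \int[mu]_b G (a ^+ 2 + b ^+ 2, rho * b)%R)%E.
Proof.
move=> mG G0 rho0 rhoE.
have mGc (N D : R * R -> R) : measurable_fun setT N -> measurable_fun setT D ->
    measurable_fun setT (fun z => G (N z, D z)).
  move=> mN mD; apply: (measurableT_comp mG); exact: measurable_fun_pair.
have mz1 : measurable_fun setT (fun z : R * R => z.1) by exact: measurable_fst.
have mz2 : measurable_fun setT (fun z : R * R => z.2) by exact: measurable_snd.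
have mZ (c : R) (h : R * R -> R) : measurable_fun setT h -> measurable_fun setT (fun z => c * h z).
  by move=> mh; apply: measurable_funM => //; exact: measurable_cst.
have mX (h : R * R -> R) : measurable_fun setT h -> measurable_fun setT (fun z => h z ^+ 2).
  by move=> mh; exact: measurable_funX.
have mD (h k : R * R -> R) : measurable_fun setT h -> measurable_fun setT k -> measurable_fun setT (fun z => h z + k z).
  exact: measurable_funD.
have sl1 (F : R * R -> \bar R) (c : R) : measurable_fun setT F -> measurable_fun setT (fun b : R => F (b, c)).
  by move=> mF; exact: measurable_fun_pair1.
have sl2 (F : R * R -> \bar R) (c : R) : measurable_fun setT F -> measurable_fun setT (fun b : R => F (c, b)).
  by move=> mF; exact: measurable_fun_pair2.
have m1 : measurable_fun setT (fun z : R * R => G (z.1 ^+ 2 + z.2 ^+ 2, p * z.1 + q * z.2)).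
  by apply: mGc; [apply: (mD); apply: (mX)|apply: (mD); apply: (mZ)].
have m2 : measurable_fun setT (fun z : R * R => G (z.1 ^+ 2 + z.2 ^+ 2, rho * z.2)).
  by apply: mGc; [apply: (mD); apply: (mX)|apply: (mZ)].
(* For q = 0 one has p = rho or p = -rho, and exchanging the variables suffices, with a reflection
   in the second case. *)
have [q0|q0] := eqVneq q 0.
  transitivity (\int[mu]_b \int[mu]_a G (a ^+ 2 + b ^+ 2, p * a + q * b)%R)%E.
    exact: (@fubini_tonelli _ _ _ _ R mu mu _ m1 (fun=> G0 _)).
  apply: eq_integral => a _.
  have : (p - rho) * (p + rho) = 0.
    by rewrite q0 expr0n /= addr0 in rhoE; rewrite -subr_sqr rhoE subrr.
  move=> /eqP; rewrite mulf_eq0 subr_eq0 addr_eq0 => /orP[] /eqP pE.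
    by apply: eq_integral => b _; rewrite q0 mul0r addr0 pE addrC.
  rewrite (@integral_affine R (-1) 0 _ (fun b => G (b ^+ 2 + a ^+ 2, p * b + q * a)%R)) ?oppr_eq0 ?oner_eq0//; last first.
    exact: (sl1 _ a m1).
  rewrite normrN1 mul1e; apply: eq_integral => b _; rewrite q0 pE; congr (G (_, _)); ring.
have rn0 : rho != 0.
  apply: contraNneq q0 => r0; move: rhoE; rewrite r0 expr0n /= => /esym/eqP.
  by rewrite paddr_eq0 ?sqr_ge0// => /andP[_]; rewrite sqrf_eq0.
pose k := rho / q.
have k0 : k != 0 by rewrite mulf_neq0 ?invr_eq0.
pose N (z : R * R) := z.1 ^+ 2 + (k * z.2 + (- (p / q)) * z.1) ^+ 2.
have mN : measurable_fun setT (fun z : R * R => G (N z, rho * z.2)).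
  by apply: mGc; [apply: (mD); apply: (mX) => //; apply: (mD); apply: (mZ)|apply: (mZ)].
transitivity (\int[mu]_a \int[mu]_b (`|k|%:E * G (N (a, b), rho * b)%R))%E.
  apply: eq_integral => a _.
  rewrite (@integral_affine R k (- (p / q) * a) k0 (fun b => G (a ^+ 2 + b ^+ 2, p * a + q * b)%R))//; last first.
    exact: (sl2 _ a m1).
  transitivity (`|k|%:E * \int[mu]_b G (N (a, b), rho * b)%R)%E.
    congr (_ * _)%E; apply: eq_integral => b _; congr (G (_, _)); rewrite /k; field.
    exact: q0.
  rewrite -ge0_integralZl//; exact: (sl2 _ a mN).
transitivity (\int[mu]_b \int[mu]_a (`|k|%:E * G (N (a, b), rho * b)%R))%E.
  apply: (@fubini_tonelli _ _ _ _ R mu mu (fun z => `|k|%:E * G (N z, rho * z.2)%R)%E).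
    by apply: emeasurable_funM => //; exact: measurable_cst.
  by move=> z; rewrite mule_ge0.
transitivity (\int[mu]_b \int[mu]_a G (a ^+ 2 + b ^+ 2, rho * b)%R)%E; last first.
  exact/esym/(@fubini_tonelli _ _ _ _ R mu mu _ m2 (fun=> G0 _)).
apply: eq_integral => b _.
rewrite (@integral_affine R k (- (p / q) * b) k0 (fun a => G (a ^+ 2 + b ^+ 2, rho * b)%R))//; last first.
  exact: (sl1 _ b m2).
rewrite ge0_integralZl//; last first.
  exact: (sl1 _ b mN).
congr (_ * _)%E; apply: eq_integral => a _; congr (G (_, _)).
rewrite /N /k /=.
have -> : (rho / q * b + - (p / q) * a) ^+ 2 = (rho ^+ 2 * b ^+ 2 - 2 * rho * p * a * b + p ^+ 2 * a ^+ 2) / q ^+ 2 by field.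
have -> : (rho / q * a + - (p / q) * b) ^+ 2 = (rho ^+ 2 * a ^+ 2 - 2 * rho * p * a * b + p ^+ 2 * b ^+ 2) / q ^+ 2 by field.
by rewrite rhoE; field.
Qed.

(* Two planar rotations bring x to the third axis. *)
Lemma rotate3 (H : R * R -> \bar R) (x : R3 R) :
  measurable_fun setT H -> (forall z, 0 <= H z)%E ->
  (\int[@leb3 R]_v H (dot3 v v, dot3 x v) =
   \int[@leb3 R]_v H (dot3 v v, enorm3 x * v.2)%R)%E.
Proof.
move=> mH H0.
pose rho := Num.sqrt (x.1.1 ^+ 2 + x.1.2 ^+ 2).
have rho0 : 0 <= rho by exact: sqrtr_ge0.
have rhoE : rho ^+ 2 = x.1.1 ^+ 2 + x.1.2 ^+ 2 by rewrite sqr_sqrtr ?addr_ge0 ?sqr_ge0.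
have xE : enorm3 x ^+ 2 = rho ^+ 2 + x.2 ^+ 2.
  by rewrite rhoE /enorm3 sqr_sqrtr dot3E -?expr2 ?addr_ge0 ?sqr_ge0.
have x0 : 0 <= enorm3 x by exact: sqrtr_ge0.
have m11 : measurable_fun setT (fun v : R3 R => v.1.1).
  by apply: (measurableT_comp measurable_fst); exact: measurable_fst.
have m12 : measurable_fun setT (fun v : R3 R => v.1.2).
  by apply: (measurableT_comp measurable_snd); exact: measurable_fst.
have m2 : measurable_fun setT (fun v : R3 R => v.2) by exact: measurable_snd.
have mHc (a b c : R) : measurable_fun setT (fun v : R3 R =>
    H (v.1.1 ^+ 2 + v.1.2 ^+ 2 + v.2 ^+ 2, a * v.1.1 + b * v.1.2 + c * v.2)).
  apply: (measurableT_comp mH); apply: measurable_fun_pair.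
    by do 2?apply: measurable_funD; exact: measurable_funX.
  by do 2?apply: measurable_funD; apply: measurable_funM.
pose h a b c (v : R3 R) := H (v.1.1 ^+ 2 + v.1.2 ^+ 2 + v.2 ^+ 2, a * v.1.1 + b * v.1.2 + c * v.2).
have mh a b c : measurable_fun setT (h a b c) by exact: mHc.
have h0 a b c v : (0 <= h a b c v)%E by exact: H0.
transitivity (\int[@leb3 R]_v h x.1.1 x.1.2 x.2 v)%E.
  by apply: eq_integral => v _; rewrite !dot3E -!expr2.
transitivity (\int[@leb3 R]_v h 0%R rho x.2 v)%E.
  rewrite (leb3_tonelli312 (mh _ _ _) (h0 _ _ _)) (leb3_tonelli312 (mh _ _ _) (h0 _ _ _)).
  apply: eq_integral => c _.
  pose G (z : R * R) := H (z.1 + c ^+ 2, z.2 + x.2 * c).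
  have mG : measurable_fun setT G.
    by apply: (measurableT_comp mH); apply: measurable_fun_pair; apply: measurable_funD.
  have rot := @rotate2 G x.1.1 x.1.2 rho mG (fun=> H0 _) rho0 rhoE.
  apply: (eq_trans (eq_trans _ rot)); apply: eq_integral => a _; apply: eq_integral => b _.
    by [].
  by rewrite /h /G /= mul0r add0r.
transitivity (\int[@leb3 R]_v h 0%R 0%R (enorm3 x) v)%E.
  rewrite (leb3_tonelli123 (mh _ _ _) (h0 _ _ _)) (leb3_tonelli123 (mh _ _ _) (h0 _ _ _)).
  apply: eq_integral => a _.
  pose G (z : R * R) := H (a ^+ 2 + z.1, z.2).
  have mG : measurable_fun setT G.
    by apply: (measurableT_comp mH); apply: measurable_fun_pair => //; apply: measurable_funD.
  have rot := @rotate2 G rho x.2 (enorm3 x) mG (fun=> H0 _) x0 xE.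
  apply: (eq_trans (eq_trans _ rot)); apply: eq_integral => b _; apply: eq_integral => c _.
    by rewrite /h /G /= mul0r add0r -addrA.
  by rewrite /h /G /= !mul0r !add0r -addrA.
by apply: eq_integral => v _; rewrite /h dot3E -!expr2 !mul0r !add0r.
Qed.
End rotation.

Section FTC.
Variable R : realType.
Notation mu := (@lebesgue_measure R).

Lemma integral_is_derive (F f : R -> R) (a b : R) : a < b ->
  (forall x : R, a <= x <= b -> is_derive x 1 F (f x)) -> {within `[a, b], continuous f} ->
  (\int[mu]_(x in `[a, b]) (f x)%:E)%E = (F b - F a)%:E.
Proof.
move=> ab dF cf; rewrite EFinB; apply: continuous_FTC2 => //.
  have cF x : a <= x <= b -> {for x, continuous F}.
    by move=> xab; apply/differentiable_continuous/derivable1_diffP; have [] := dF x xab.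
  split=> [x||].
  - by rewrite in_itv /= => /andP[ax xb]; have [] := dF x; rewrite ?(ltW ax) ?(ltW xb).
  - by apply: cvg_at_right_filter; apply: cF; rewrite lexx ltW.
  - by apply: cvg_at_left_filter; apply: cF; rewrite lexx ltW.
move=> x; rewrite in_itv /= => /andP[ax xb].
by rewrite derive1E; have [] := dF x; rewrite ?(ltW ax) ?(ltW xb).
Qed.
End FTC.

(** * Momentum integrals *)

Section three_halves.
Variable R : realType.

(* Num.sqrt vanishes on negative numbers, hence so does this power z^(3/2). *)
Definition pow32 (z : R) : R := z * Num.sqrt z.

Lemma pow32_le0 z : z <= 0 -> pow32 z = 0.
Proof. by move=> z0; rewrite /pow32 ler0_sqrtr ?mulr0. Qed.

Lemma pow32_ge0 z : 0 <= pow32 z.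
Proof.
have [z0|/ltW z0] := leP z 0; first by rewrite pow32_le0.
by rewrite mulr_ge0 ?sqrtr_ge0.
Qed.

Lemma pow32M (k z : R) : 0 <= k -> pow32 (k * z) = pow32 k * pow32 z.
Proof. by move=> k0; rewrite /pow32 sqrtrM// mulrACA. Qed.

(** At 0 the difference quotient is the square root itself. This regularity at the edge of the
    support lets f solve the Vlasov equation classically. *)
Lemma is_derive_pow32 (z : R) : is_derive z 1 pow32 (3 / 2 * Num.sqrt z).
Proof.
have [z0|z0|->] := ltgtP z 0.
- rewrite ltr0_sqrtr// mulr0.
  apply: (@near_eq_is_derive _ _ _ (fun=> 0)).
  near=> x; rewrite pow32_le0//; apply: ltW; near: x; exact: lt_nbhsl.
- have d1 := is_derive1_sqrt z0.
  have s0 : 0 < Num.sqrt z by rewrite sqrtr_gt0.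
  rewrite /pow32; apply: is_derive_eq; rewrite /GRing.scale /=.
  by rewrite -{1}(sqr_sqrtr (ltW z0)); field; rewrite gt_eqF.
rewrite sqrtr0 mulr0; apply/is_derive1_caratheodory; exists Num.sqrt; split.
- by move=> x; rewrite (pow32_le0 (lexx 0)) !subr0 mulrC.
- exact: sqrt_continuous.
- exact: sqrtr0.
Unshelve. all: by end_near. Qed.

Lemma continuous_pow32 : continuous pow32.
Proof. exact: is_derive_continuous is_derive_pow32. Qed.
End three_halves.

Section radial_moment.
Variable R : realType.
Notation mu := (@lebesgue_measure R).

Let D : set R := `[-1, 1]%classic.
Let psi (z : R) := pow32 (1 - z ^+ 2).

Let cpsi : continuous psi.
Proof.
move=> z; apply: (@continuous_comp _ _ _ (fun z : R => 1 - z ^+ 2) (@pow32 R)).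
  by apply: cvgB; [exact: cvg_cst|exact: exprn_continuous].
exact: continuous_pow32.
Qed.

Let mD : measurable (D : set (measurableTypeR R)).
Proof. exact: measurable_itv. Qed.

Let cpol (a b : R) : continuous (fun z : R => (a + b * z ^+ 2) * psi z).
Proof.
move=> z; apply: cvgM; last exact: cpsi.
apply: cvgD; first exact: cvg_cst.
by apply: cvgM; [exact: cvg_cst|exact: exprn_continuous].
Qed.

Let ipol a b : mu.-integrable D (EFin \o (fun z : R => (a + b * z ^+ 2) * psi z)).
Proof.
apply: continuous_compact_integrable; first exact: segment_compact.
by apply: continuous_subspaceT; exact: cpol.
Qed.

Let ipolZ k a b :
  mu.-integrable D (EFin \o (fun z : R => k * ((a + b * z ^+ 2) * psi z))).
Proof.
have -> : (fun z : R => k * ((a + b * z ^+ 2) * psi z)) =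
    (fun z : R => (k * a + k * b * z ^+ 2) * psi z) by apply/funext => z; ring.
exact: ipol.
Qed.

(** The form 0 + 1 * z^2 makes this an instance of [ipol]. The value is left unevaluated: its
    positivity allows it to be absorbed into the amplitude A. *)
Definition mom1 : R := \int[mu]_(z in D) ((0 + 1 * z ^+ 2) * psi z).

(** The integrand has the primitive z (1 - z^2)^(5/2), which vanishes at both ends. So the integral
    of [psi] is 6 [mom1], the origin of the 6 in [rhohat]. *)
Let mom6 : (\int[mu]_(z in D) ((1 + -6 * z ^+ 2) * psi z))%R = 0.
Proof.
pose F (z : R) := z * (1 - z ^+ 2) * psi z.
have dF (x : R) : -1 <= x <= 1 -> is_derive x 1 F ((1 + -6 * x ^+ 2) * psi x).
  move=> _.
  have d0 : is_derive x 1 (fun z : R => 1 - z ^+ 2) (- (2 * x)).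
    by apply: is_derive_eq; rewrite /GRing.scale /=; ring.
  have d1 := @is_derive1_comp _ (@pow32 R) (fun z : R => 1 - z ^+ 2) x _ _ (is_derive_pow32 _) d0.
  have d2 : is_derive x 1 psi (3 / 2 * Num.sqrt (1 - x ^+ 2) * - (2 * x)) by exact: d1.
  by rewrite /F; apply: is_derive_eq; rewrite /GRing.scale /= /psi /pow32; field.
have cd : {within `[(-1 : R), 1], continuous (fun x : R => (1 + -6 * x ^+ 2) * psi x)}.
  by apply: continuous_subspaceT; exact: cpol.
rewrite /Rintegral (integral_is_derive _ dF cd)/=; last lra.
by rewrite /F !expr2 mulrNN mulr1 subrr !mulr0 !mul0r subrr.
Qed.

Lemma mom1_gt0 : 0 < mom1.
Proof.
pose f (z : R) := z ^+ 2 * (1 - z ^+ 2) ^+ 2.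
pose F (z : R) := z ^+ 3 / 3 - 2 * z ^+ 5 / 5 + z ^+ 7 / 7.
have cf : continuous f.
  move=> z; apply: cvgM; first exact: exprn_continuous.
  apply: (@continuous_comp _ _ _ (fun z : R => 1 - z ^+ 2) (fun z => z ^+ 2)); last exact: exprn_continuous.
  by apply: cvgB; [exact: cvg_cst|exact: exprn_continuous].
have E : (\int[mu]_(z in D) f z)%R = 16 / 105.
  have dF (x : R) : -1 <= x <= 1 -> is_derive x 1 F (f x).
    by move=> _; rewrite /F; apply: is_derive_eq; rewrite /GRing.scale /= /f; field.
  have cd : {within `[(-1 : R), 1], continuous f} by apply: continuous_subspaceT; exact: cf.
  rewrite /Rintegral (integral_is_derive _ dF cd)/=; last lra.
  by rewrite /F; field.
apply: (@lt_le_trans _ _ (16 / 105)); first by rewrite divr_gt0.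
rewrite -E /mom1; apply: le_Rintegral => //.
- apply: continuous_compact_integrable; first exact: segment_compact.
  by apply: continuous_subspaceT; exact: cf.
move=> z; rewrite /D /= in_itv /= => z1.
have w0 : 0 <= 1 - z ^+ 2 by nra.
rewrite add0r mul1r /f; apply: ler_wpM2l; first exact: sqr_ge0.
rewrite /psi /pow32 expr2 ler_wpM2l//.
rewrite -{1}(sqr_sqrtr w0) expr2 ler_piMl ?sqrtr_ge0// -[leRHS]sqrtr1 ler_wsqrtr//.
by have := sqr_ge0 z; lra.
Qed.

Lemma radial_moment (a b : R) : 0 <= a -> 0 <= b ->
  (\int[mu]_z ((a + b * z ^+ 2) * pow32 (1 - z ^+ 2))%:E = ((6 * a + b) * mom1)%:E)%E.
Proof.
move=> a0 b0.
transitivity (\int[mu]_(z in D) ((a + b * z ^+ 2) * psi z)%:E)%E.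
  rewrite [RHS]integral_mkcond; apply: eq_integral => z _.
  rewrite /patch; case: ifPn => // zD; rewrite pow32_le0 ?mulr0//.
  move: zD; rewrite /D notin_setE /= in_itv /= => /negP; rewrite -ler_norml -ltNge => z1.
  by rewrite subr_le0 -real_normK ?num_real// expr_ge1// ltW.
have h : (\int[mu]_(z in D) ((a + b * z ^+ 2) * psi z))%R = (6 * a + b) * mom1.
  have -> : (6 * a + b) * mom1 = a * (\int[mu]_(z in D) ((1 + -6 * z ^+ 2) * psi z))%R + (6 * a + b) * mom1.
    by rewrite mom6 mulr0 add0r.
  rewrite /mom1 -(RintegralZl a mD (ipol _ _)) -(RintegralZl _ mD (ipol _ _)).
  rewrite -(RintegralD mD).
  - by apply: eq_Rintegral => z _; ring.
  - exact: ipolZ.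
  - exact: ipolZ.
rewrite -h /Rintegral fineK//.
by apply: integrable_fin_num => //; exact: ipol.
Qed.

End radial_moment.

Section moments.
Variable R : realType.
Notation mu := (@lebesgue_measure R).

Lemma integral_scale (f : R -> \bar R) (r : R) : 0 < r -> measurable_fun setT f ->
  (forall x, 0 <= f x)%E ->
  (\int[mu]_x f (r * x)%R = r^-1%:E * \int[mu]_x f x)%E.
Proof.
move=> r0 mf f0; have ri0 : r^-1 != 0 by rewrite invr_eq0 gt_eqF.
rewrite (@integral_affine R r^-1 0 ri0 (fun x => f (r * x)%R))//; last first.
  by apply: (measurableT_comp mf); exact: measurable_funM.
rewrite gtr0_norm ?invr_gt0//; congr (_ * _)%E; apply: eq_integral => x _.
by rewrite addr0 mulVKf// gt_eqF.
Qed.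

(** For y > 0 the argument of [pow32] equals be (T y - w^2), so w = sqrt(T y) z reduces the integral
    to [radial_moment]. If T y = 0 both sides vanish. *)
Lemma axial_moment (c0 c1 T be r : R) : 0 <= c0 -> 0 <= c1 -> 0 <= T -> 0 < be ->
  let y := Num.max (r ^+ 2 / be - 1) 0 in
  (\int[mu]_w ((c0 * T + c1 * w ^+ 2) * pow32 (r ^+ 2 * T - be * (T + w ^+ 2)))%:E =
   (T ^+ 3 * (pow32 be * y ^+ 2 * (6 * c0 + c1 * y) * mom1 R))%:E)%E.
Proof.
move=> c00 c10 T0 be0 y.
have y0 : 0 <= y by rewrite le_max lexx orbT.
have [Ty0|Ty0] := eqVneq (T * y) 0.
  have -> : T ^+ 3 * (pow32 be * y ^+ 2 * (6 * c0 + c1 * y) * mom1 R) = 0.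
    have -> : T ^+ 3 * (pow32 be * y ^+ 2 * (6 * c0 + c1 * y) * mom1 R) =
      (T * y) ^+ 2 * T * (pow32 be * (6 * c0 + c1 * y) * mom1 R) by ring.
    by rewrite Ty0 expr0n /= !mul0r.
  apply: integral0_eq => w _; rewrite pow32_le0 ?mulr0//.
  have w0 : 0 <= be * w ^+ 2 by rewrite mulr_ge0 ?sqr_ge0// ltW.
  move/eqP: Ty0; rewrite mulf_eq0 => /orP[/eqP ->|/eqP yE]; first lra.
  have : r ^+ 2 / be - 1 <= 0 by rewrite -yE le_max lexx.
  rewrite subr_le0 ler_pdivrMr// mul1r => rb.
  have : r ^+ 2 * T <= be * T by rewrite ler_wpM2r.
  lra.
have yp : 0 < y by rewrite lt_neqAle y0 andbT; apply: contraNneq Ty0 => <-; rewrite mulr0.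
have Tp : 0 < T by rewrite lt_neqAle T0 andbT; apply: contraNneq Ty0 => <-; rewrite mul0r.
have yE : r ^+ 2 = be * (1 + y).
  have : r ^+ 2 / be - 1 = y.
    by move: yp; rewrite /y lt_max ltxx orbF => /ltW/max_l.
  by move=> <-; field; rewrite gt_eqF.
have Typ : 0 < T * y by rewrite mulr_gt0.
pose k := Num.sqrt (T * y).
have k0 : 0 < k by rewrite sqrtr_gt0.
have k2 : k ^+ 2 = T * y by rewrite sqr_sqrtr// ltW.
rewrite (@integral_affine R k 0 (lt0r_neq0 k0) (fun w => ((c0 * T + c1 * w ^+ 2) * pow32 (r ^+ 2 * T - be * (T + w ^+ 2)))%:E)); first last.
- move=> w; rewrite lee_fin mulr_ge0 ?pow32_ge0//.
  by rewrite addr_ge0// mulr_ge0// sqr_ge0.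
- apply/measurable_EFinP; apply: continuous_measurable_fun => w; apply: cvgM.
    apply: cvgD; first exact: cvg_cst.
    by apply: cvgM; [exact: cvg_cst|exact: exprn_continuous].
  apply: (@continuous_comp _ _ _ (fun w : R => r ^+ 2 * T - be * (T + w ^+ 2)) (@pow32 R)); last exact: continuous_pow32.
  apply: cvgB; first exact: cvg_cst.
  apply: cvgM; first exact: cvg_cst.
  by apply: cvgD; [exact: cvg_cst|exact: exprn_continuous].
rewrite gtr0_norm//.
transitivity (k%:E * \int[mu]_x ((T * pow32 (be * (T * y)))%:E * ((c0 + c1 * y * x ^+ 2) * pow32 (1 - x ^+ 2))%:E))%E.
  congr (_ * _)%E; apply: eq_integral => x _; rewrite -EFinM; congr EFin.
  rewrite addr0 exprMn k2 yE.
  have -> : be * (1 + y) * T - be * (T + T * y * x ^+ 2) = be * (T * y) * (1 - x ^+ 2) by ring.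
  by rewrite pow32M ?mulr_ge0 ?ltW//; ring.
rewrite ge0_integralZl//; first last.
- by rewrite lee_fin mulr_ge0 ?pow32_ge0.
- move=> x _; rewrite lee_fin mulr_ge0 ?pow32_ge0// addr_ge0//.
  by rewrite mulr_ge0 ?sqr_ge0// mulr_ge0.
- apply/measurable_EFinP; apply: continuous_measurable_fun => w; apply: cvgM.
    apply: cvgD; first exact: cvg_cst.
    by apply: cvgM; [exact: cvg_cst|exact: exprn_continuous].
  apply: (@continuous_comp _ _ _ (fun w : R => 1 - w ^+ 2) (@pow32 R)); last exact: continuous_pow32.
  by apply: cvgB; [exact: cvg_cst|exact: exprn_continuous].
rewrite radial_moment ?mulr_ge0// -!EFinM; congr EFin.
rewrite pow32M ?(ltW be0)// [pow32 (T * y)]/pow32 -/k.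
have -> : k * (T * (pow32 be * (T * y * k)) * ((6 * c0 + c1 * y) * mom1 R)) =
  k ^+ 2 * (T * (pow32 be * (T * y)) * ((6 * c0 + c1 * y) * mom1 R)) by ring.
by rewrite k2; ring.
Qed.

Let h (z : R * R) : R := (z.1 ^+ 2 + z.2 ^+ 2) ^+ 3 * expR (- (2 * (z.1 ^+ 2 + z.2 ^+ 2))).

Let h_ge0 z : 0 <= h z.
Proof. by rewrite mulr_ge0 ?expR_ge0// exprn_ge0// addr_ge0 ?sqr_ge0. Qed.

Let mh : measurable_fun setT h.
Proof.
have mz1 : measurable_fun setT (fun z : R * R => z.1) by exact: measurable_fst.
have mz2 : measurable_fun setT (fun z : R * R => z.2) by exact: measurable_snd.
have mT : measurable_fun setT (fun z : R * R => z.1 ^+ 2 + z.2 ^+ 2).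
  by apply: measurable_funD; exact: measurable_funX.
apply: measurable_funM; first exact: measurable_funX.
apply: (measurableT_comp (@measurable_expR R)); apply: measurable_funN.
by apply: measurable_funM => //; exact: measurable_cst.
Qed.

Let mhE : measurable_fun setT (EFin \o h).
Proof. exact/measurable_EFinP. Qed.

Let Phi (a : R) : \bar R := (\int[mu]_b (h (a, b))%:E)%E.

Let mPhi : measurable_fun setT Phi.
Proof. by apply: (@measurable_fun_fubini_tonelli_F _ _ _ _ R mu (EFin \o h) mhE) => z; rewrite lee_fin. Qed.

Let Phi_ge0 a : (0 <= Phi a)%E.
Proof. by apply: integral_ge0 => b _; rewrite lee_fin. Qed.

Definition mom0 : R := fine (\int[mu]_a \int[mu]_b ((a ^+ 2 + b ^+ 2) ^+ 3 * expR (- (2 * (a ^+ 2 + b ^+ 2))))%:E)%E.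

Let msec a : measurable_fun setT (fun b : R => (h (a, b))%:E).
Proof. exact: (@measurable_fun_pair2 _ _ _ _ _ _ _ a mhE). Qed.

(** From (T / 3)^3 <= e^T one factor e^(-T) absorbs T^3 up to 27, and the other is a product of two
    Gaussians. *)
Let Phi_fin : (\int[mu]_a Phi a < +oo)%E.
Proof.
pose g := (@gauss_fun R).
have mg : measurable_fun setT (EFin \o g) by apply/measurable_EFinP; exact: measurable_gauss_fun.
have hg a b : h (a, b) <= 27 * g a * g b.
  rewrite /h /g /gauss_fun /= -mulrA -expRD.
  set T := a ^+ 2 + b ^+ 2.
  have T0 : 0 <= T by rewrite addr_ge0 ?sqr_ge0.
  have -> : - a ^+ 2 - b ^+ 2 = - T by rewrite /T; ring.
  have -> : - (2 * T) = T * (- 1) + - T - T * (1 - 1) - T * 1 + T by ring.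
  have -> : T * (- 1) + - T - T * (1 - 1) - T * 1 + T = - T - T by ring.
  rewrite expRD mulrA ler_wpM2r ?expR_ge0// expRN ler_pdivrMr ?expR_gt0//.
  have -> : expR T = expR (T / 3) ^+ 3 by rewrite -expRM_natl; congr expR; field.
  have : (T / 3) ^+ 3 <= expR (T / 3) ^+ 3.
    rewrite lerXn2r ?nnegrE ?expR_ge0 ?divr_ge0//.
    by apply: le_trans (expR_ge1Dx _); rewrite lerDr.
  rewrite expr_div_n ler_pdivrMr ?exprn_gt0//.
  by rewrite mulrC; congr (_ <= _ * _); rewrite -natrX.
have gI : (\int[mu]_x (g x)%:E)%E = (Num.sqrt pi)%:E by exact: integralT_gauss.
apply: (@le_lt_trans _ _ (\int[mu]_a ((27 * Num.sqrt pi)%:E * (g a)%:E))%E); last first.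
  rewrite ge0_integralZl//; first last.
    by move=> x _; rewrite lee_fin gauss_fun_ge0.
  by rewrite gI -EFinM ltry.
apply: ge0_le_integral => //; first last.
- move=> a _; apply: (@le_trans _ _ (\int[mu]_b ((27 * g a)%:E * (g b)%:E))%E).
    apply: ge0_le_integral => //.
    + by move=> b _; rewrite lee_fin.
    + exact: msec.
    + by apply: emeasurable_funM => //; exact: measurable_cst.
    + by move=> b _; rewrite -EFinM lee_fin.
  rewrite ge0_integralZl//; first last.
  - by rewrite lee_fin mulr_ge0 ?gauss_fun_ge0.
  - by move=> x _; rewrite lee_fin gauss_fun_ge0.
  by rewrite gI -!EFinM lee_fin mulrAC.
- by apply: emeasurable_funM => //; exact: measurable_cst.
Qed.

Lemma mom0E : (\int[mu]_a Phi a)%E = mom0%:E.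
Proof.
rewrite /mom0 fineK// ge0_fin_numE; first exact: Phi_fin.
by apply: integral_ge0 => a _; exact: Phi_ge0.
Qed.

Lemma mom0_gt0 : 0 < mom0.
Proof.
(* On the unit square with a and b in [1, 2] one has 2 <= a^2 + b^2 <= 8, so c bounds the integrand
   from below. *)
pose c : R := 8 * expR (- 16).
have c0 : 0 < c by rewrite mulr_gt0 ?expR_gt0.
suff : (c%:E <= mom0%:E)%E by rewrite lee_fin; exact: lt_le_trans.
rewrite -mom0E.
have I1 : mu (`[1, 2]%classic : set R) = 1%E.
  rewrite lebesgue_measure_itv /= lte_fin ltr1n -EFinB; congr EFin; ring.
have mI : measurable (`[1, 2]%classic : set (measurableTypeR R)) by exact: measurable_itv.
have Ic : (\int[mu]_(x in `[1%R, 2%R]) (cst c%:E) x)%E = c%:E.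
  transitivity (c%:E * 1)%E; last exact: mule1.
  by rewrite -I1; exact: integral_cst.
rewrite -{1}Ic.
apply: (@le_trans _ _ (\int[mu]_(x in `[1%R, 2%R]) Phi x)%E); last first.
  by apply: ge0_subset_integral.
apply: ge0_le_integral => //.
- by move=> x _; rewrite lee_fin ltW.
- exact: measurable_funTS.
move=> a; rewrite /= in_itv /= => a12.
rewrite -Ic; apply: (@le_trans _ _ (\int[mu]_(b in `[1%R, 2%R]) (h (a, b))%:E)%E); last first.
  by apply: ge0_subset_integral => //; [exact: msec|move=> b _; rewrite lee_fin].
apply: ge0_le_integral => //.
- by move=> x _; rewrite lee_fin ltW.
- exact: (measurable_funTS (msec a)).
move=> b; rewrite /= in_itv /= => b12; rewrite lee_fin /c /h /=.
have h1 : 2 <= a ^+ 2 + b ^+ 2 by nra.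
have h2 : a ^+ 2 + b ^+ 2 <= 8 by nra.
apply: ler_pM; rewrite ?expR_ge0//.
  have -> : 8 = 2 ^+ 3 :> R by ring.
  by rewrite lerXn2r ?nnegrE//; lra.
by rewrite ler_expR; lra.
Qed.

(** Scaling by r: the cube of a^2 + b^2 yields r^-6 and the two integrations yield r^-2. *)
Lemma planar_moment (r : R) : 0 < r ->
  (\int[mu]_a \int[mu]_b ((a ^+ 2 + b ^+ 2) ^+ 3 * expR (- (2 * (r ^+ 2 * (a ^+ 2 + b ^+ 2)))))%:E =
  (mom0 / r ^+ 8)%:E)%E.
Proof.
move=> r0.
transitivity (\int[mu]_a ((r ^- 7)%:E * Phi (r * a)))%E.
  apply: eq_integral => a _.
  transitivity (\int[mu]_b ((r ^- 6)%:E * (h (r * a, r * b))%:E))%E.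
    apply: eq_integral => b _; rewrite -EFinM /h /= !exprMn -mulrDr; congr EFin.
    by field; rewrite gt_eqF.
  rewrite (ge0_integralZl _ measurableT); first last.
  - by rewrite lee_fin invr_ge0 exprn_ge0// ltW.
  - by move=> b _; rewrite lee_fin.
  - apply: (measurableT_comp (msec (r * a))); exact: measurable_funM.
  rewrite (integral_scale r0 (msec (r * a))); last by move=> b; rewrite lee_fin.
  rewrite muleA -EFinM; congr (_%:E * _)%E.
  by field; rewrite gt_eqF.
rewrite (ge0_integralZl _ measurableT); first last.
- by rewrite lee_fin invr_ge0 exprn_ge0// ltW.
- by move=> a _; exact: Phi_ge0.
- by apply: (measurableT_comp mPhi); exact: measurable_funM.
rewrite (integral_scale r0 mPhi)// mom0E -!EFinM; congr EFin.
by field; rewrite gt_eqF.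
Qed.

Theorem shell_moment (c0 c1 be r : R) : 0 <= c0 -> 0 <= c1 -> 0 < be -> 0 < r ->
  let y := Num.max (r ^+ 2 / be - 1) 0 in
  (\int[@leb3 R]_v ((c0 * (v.1.1 ^+ 2 + v.1.2 ^+ 2) + c1 * v.2 ^+ 2) *
     pow32 (r ^+ 2 * (v.1.1 ^+ 2 + v.1.2 ^+ 2) - be * (v.1.1 ^+ 2 + v.1.2 ^+ 2 + v.2 ^+ 2)) *
     expR (- (2 * (r ^+ 2 * (v.1.1 ^+ 2 + v.1.2 ^+ 2)))))%:E =
  (mom0 * mom1 R * (pow32 be * y ^+ 2 * (6 * c0 + c1 * y)) / r ^+ 8)%:E)%E.
Proof.
move=> c00 c10 be0 r0 y.
have y0 : 0 <= y by rewrite le_max lexx orbT.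
have m11 : measurable_fun setT (fun v : R3 R => v.1.1).
  by apply: (measurableT_comp measurable_fst); exact: measurable_fst.
have m12 : measurable_fun setT (fun v : R3 R => v.1.2).
  by apply: (measurableT_comp measurable_snd); exact: measurable_fst.
have m2 : measurable_fun setT (fun v : R3 R => v.2) by exact: measurable_snd.
have mT : measurable_fun setT (fun v : R3 R => v.1.1 ^+ 2 + v.1.2 ^+ 2).
  by apply: measurable_funD; exact: measurable_funX.
have mw : measurable_fun setT (fun v : R3 R => v.2 ^+ 2) by exact: measurable_funX.
have mp : measurable_fun setT (@pow32 R) by apply: continuous_measurable_fun; exact: continuous_pow32.
have mZ (c : R) (F : R3 R -> R) : measurable_fun setT F -> measurable_fun setT (fun v => c * F v).
  by move=> mF; apply: measurable_funM => //; exact: measurable_cst.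
rewrite leb3_tonelli123; first last.
- move=> v; rewrite lee_fin; apply: mulr_ge0; last exact: expR_ge0.
  apply: mulr_ge0; last exact: pow32_ge0.
  by apply: addr_ge0; apply: mulr_ge0 => //; rewrite ?addr_ge0 ?sqr_ge0.
- apply/measurable_EFinP; apply: measurable_funM.
    apply: measurable_funM.
      by apply: measurable_funD; exact: mZ.
    apply: (measurableT_comp mp); apply: measurable_funB; apply: mZ => //.
    exact: measurable_funD.
  apply: (measurableT_comp (@measurable_expR R)); apply: measurable_funN.
  exact: (mZ _ _ (mZ _ _ mT)).
pose M := pow32 be * y ^+ 2 * (6 * c0 + c1 * y) * mom1 R.
have M0 : 0 <= M.
  apply: mulr_ge0; last exact/ltW/mom1_gt0.
  apply: mulr_ge0; last by rewrite addr_ge0 ?mulr_ge0.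
  by rewrite mulr_ge0 ?pow32_ge0 ?sqr_ge0.
transitivity (\int[mu]_a \int[mu]_b (M%:E * ((a ^+ 2 + b ^+ 2) ^+ 3 * expR (- (2 * (r ^+ 2 * (a ^+ 2 + b ^+ 2)))))%R%:E))%E.
  apply: eq_integral => a _; apply: eq_integral => b _.
  set T := a ^+ 2 + b ^+ 2; set e := expR _.
  have T0 : 0 <= T by rewrite addr_ge0 ?sqr_ge0.
  have e0 : 0 <= e by exact: expR_ge0.
  transitivity (\int[mu]_w (e%:E * ((c0 * T + c1 * w ^+ 2) * pow32 (r ^+ 2 * T - be * (T + w ^+ 2)))%:E))%E.
    by apply: eq_integral => w _; rewrite -EFinM; congr EFin; rewrite /= mulrC.
  rewrite ge0_integralZl//; first last.
  - move=> w _; rewrite lee_fin; apply: mulr_ge0; last exact: pow32_ge0.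
    by rewrite addr_ge0// mulr_ge0// sqr_ge0.
  - apply/measurable_EFinP; apply: continuous_measurable_fun => w; apply: cvgM.
      apply: cvgD; first exact: cvg_cst.
      by apply: cvgM; [exact: cvg_cst|exact: exprn_continuous].
    apply: (@continuous_comp _ _ _ (fun w : R => r ^+ 2 * T - be * (T + w ^+ 2)) (@pow32 R)); last exact: continuous_pow32.
    apply: cvgB; first exact: cvg_cst.
    apply: cvgM; first exact: cvg_cst.
    by apply: cvgD; [exact: cvg_cst|exact: exprn_continuous].
  rewrite axial_moment// -/y -!EFinM /M; congr EFin; ring.
pose h' (z : R * R) : R := (z.1 ^+ 2 + z.2 ^+ 2) ^+ 3 * expR (- (2 * (r ^+ 2 * (z.1 ^+ 2 + z.2 ^+ 2)))).
have h'0 z : 0 <= h' z.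
  by rewrite mulr_ge0 ?expR_ge0// exprn_ge0// addr_ge0 ?sqr_ge0.
have mh' : measurable_fun setT (EFin \o h').
  have mz1 : measurable_fun setT (fun z : R * R => z.1) by exact: measurable_fst.
  have mz2 : measurable_fun setT (fun z : R * R => z.2) by exact: measurable_snd.
  have mT2 : measurable_fun setT (fun z : R * R => z.1 ^+ 2 + z.2 ^+ 2).
    by apply: measurable_funD; exact: measurable_funX.
  apply/measurable_EFinP; apply: measurable_funM; first exact: measurable_funX.
  apply: (measurableT_comp (@measurable_expR R)); apply: measurable_funN.
  apply: measurable_funM; first exact: measurable_cst.
  by apply: measurable_funM => //; exact: measurable_cst.
transitivity (M%:E * \int[mu]_a \int[mu]_b (h' (a, b))%:E)%E.
  rewrite -(ge0_integralZl _ measurableT); first last.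
  - by rewrite lee_fin.
  - by move=> a _; apply: integral_ge0 => b _; rewrite lee_fin.
  - by apply: (@measurable_fun_fubini_tonelli_F _ _ _ _ R mu (EFin \o h') mh') => z; rewrite lee_fin.
  apply: eq_integral => a _; rewrite ge0_integralZl//; first last.
  - by move=> b _; rewrite lee_fin; exact: (h'0 (a, b)).
  - exact: (@measurable_fun_pair2 _ _ _ _ _ _ _ a mh').
rewrite planar_moment// -EFinM /M; congr EFin.
by field; rewrite gt_eqF.
Qed.
End moments.

(** * Matter quantities in terms of dot products *)

Section matter.
Variable R : realType.

(* This is |x × v|^2, by Lagrange's identity. *)
Definition angmom2 (x v : R3 R) : R := dot3 x x * dot3 v v - dot3 x v ^+ 2.

Lemma dot3_ge0 (x : R3 R) : 0 <= dot3 x x.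
Proof. by rewrite dot3E !addr_ge0// -expr2 sqr_ge0. Qed.

Lemma dot3_gt0 (x : R3 R) : x != 0 -> 0 < dot3 x x.
Proof.
move=> x0; rewrite lt_neqAle dot3_ge0 andbT eq_sym dot3E -!expr2.
apply: contraNneq x0; case: x => [[x1 x2] x3] /= /eqP.
rewrite !paddr_eq0 ?addr_ge0 ?sqr_ge0// !sqrf_eq0 => /andP[/andP[/eqP-> /eqP->] /eqP->].
by [].
Qed.

Lemma enorm3_sqr (x : R3 R) : enorm3 x ^+ 2 = dot3 x x.
Proof. by rewrite sqr_sqrtr// dot3_ge0. Qed.

Lemma enorm3_gt0 (x : R3 R) : x != 0 -> 0 < enorm3 x.
Proof. by move=> x0; rewrite sqrtr_gt0 dot3_gt0. Qed.

Lemma enorm3_cross (x v : R3 R) (c : R) :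
  enorm3 (scale3 c (cross3 x v)) ^+ 2 = c ^+ 2 * angmom2 x v.
Proof. by rewrite enorm3_sqr /angmom2 !dot3E /=; ring. Qed.

Lemma shell_integral (c0 c1 be : R) (x : R3 R) :
  0 <= c0 -> 0 <= c1 -> 0 < be -> x != 0 ->
  let r := enorm3 x in let y := Num.max (r ^+ 2 / be - 1) 0 in
  (\int[@leb3 R]_v ((c0 * (dot3 v v - (dot3 x v / r) ^+ 2) + c1 * (dot3 x v / r) ^+ 2) *
     pow32 (angmom2 x v - be * dot3 v v) * expR (- (2 * angmom2 x v)))%:E =
  (mom0 R * mom1 R * (pow32 be * y ^+ 2 * (6 * c0 + c1 * y)) / r ^+ 8)%:E)%E.
Proof.
move=> c00 c10 be0 x0 r y; have r0 : 0 < r by exact: enorm3_gt0.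
have r2 : r ^+ 2 != 0 by rewrite expf_neq0// gt_eqF.
(* The maximum makes the integrand nonnegative for every pair (N, d), as [rotate3] demands; on pairs
   coming from a vector it changes nothing. *)
pose g (N d : R) : R := Num.max (c0 * (N - (d / r) ^+ 2) + c1 * (d / r) ^+ 2) 0 *
     pow32 (r ^+ 2 * N - d ^+ 2 - be * N) * expR (- (2 * (r ^+ 2 * N - d ^+ 2))).
pose H (z : R * R) : \bar R := (g z.1 z.2)%:E.
have mp : measurable_fun setT (@pow32 R).
  by apply: continuous_measurable_fun; exact: continuous_pow32.
have mH : measurable_fun setT H.
  have mz1 : measurable_fun setT (fun z : R * R => z.1) by exact: measurable_fst.
  have mz2 : measurable_fun setT (fun z : R * R => z.2) by exact: measurable_snd.
  have mZ (c : R) (F : R * R -> R) : measurable_fun setT F -> measurable_fun setT (fun v => c * F v).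
    by move=> mF; apply: measurable_funM => //; exact: measurable_cst.
  have md : measurable_fun setT (fun z : R * R => (z.2 / r) ^+ 2).
    by apply/measurable_funX/measurable_funM => //; exact: measurable_cst.
  have mL : measurable_fun setT (fun z : R * R => r ^+ 2 * z.1 - z.2 ^+ 2).
    by apply: measurable_funB; [exact: mZ|exact: measurable_funX].
  apply/measurable_EFinP; apply: measurable_funM.
    apply: measurable_funM.
      apply: measurable_maxr; last exact: measurable_cst.
      apply: measurable_funD; first by apply: (mZ); exact: measurable_funB.
      exact: mZ.
    apply: (measurableT_comp mp); apply: measurable_funB => //; exact: mZ.
  apply: (measurableT_comp (@measurable_expR R)); apply: measurable_funN.
  exact: mZ.
have H0 z : (0 <= H z)%E.
  rewrite lee_fin; apply: mulr_ge0; last exact: expR_ge0.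
  by apply: mulr_ge0; [rewrite le_max lexx orbT|exact: pow32_ge0].
have := rotate3 x mH H0; rewrite -/r => rot.
transitivity (\int[@leb3 R]_v H (dot3 v v, dot3 x v))%E.
  apply: eq_integral => v _; rewrite /H /g /= /angmom2 -(enorm3_sqr x) -/r.
  rewrite max_l//.
  have := enorm3_cross x v r^-1; rewrite /angmom2 -(enorm3_sqr x) -/r => Lr.
  have -> : dot3 v v - (dot3 x v / r) ^+ 2 = enorm3 (scale3 r^-1 (cross3 x v)) ^+ 2.
    by rewrite Lr; field; rewrite gt_eqF.
  by apply: addr_ge0; apply: mulr_ge0 => //; exact: sqr_ge0.
rewrite rot -(shell_moment c00 c10 be0 r0); apply: eq_integral => v _; rewrite /H /g /=.
set T := v.1.1 ^+ 2 + v.1.2 ^+ 2.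
have T0 : 0 <= T by rewrite addr_ge0 ?sqr_ge0.
have -> : dot3 v v = T + v.2 ^+ 2 by rewrite dot3E -!expr2.
have -> : r * v.2 / r = v.2 by field; rewrite gt_eqF.
rewrite addrK exprMn max_l; last by rewrite addr_ge0// mulr_ge0// sqr_ge0.
by have -> : r ^+ 2 * (T + v.2 ^+ 2) - r ^+ 2 * v.2 ^+ 2 = r ^+ 2 * T by ring.
Qed.

Lemma momentum_integral (A b0 m c0 c1 y : R) (x : R3 R) (F : R3 R -> R) :
  0 < A -> 0 < b0 -> 0 <= c0 -> 0 <= c1 -> x != 0 ->
  let r := enorm3 x in
  Num.max (r ^+ 2 * expR (- 2 * m) / b0 - 1) 0 = y ->
  (forall v, v != 0 -> F v = A * expR m *
     ((c0 * (dot3 v v - (dot3 x v / r) ^+ 2) + c1 * (dot3 x v / r) ^+ 2) *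
     pow32 (angmom2 x v - b0 * expR (2 * m) * dot3 v v) * expR (- (2 * angmom2 x v)))) ->
  (\int[@leb3 R]_(v in @nz3 R) (F v)%:E =
   (A * (mom0 R * mom1 R) / Num.sqrt b0 * (y ^+ 2 * (6 * c0 + c1 * y) / (1 + y) ^+ 2) / r ^+ 4)%:E)%E.
Proof.
move=> A0 b00 c00 c10 x0 r yE FE; have r0 : 0 < r by exact: enorm3_gt0.
pose be := b0 * expR (2 * m).
have be0 : 0 < be by rewrite mulr_gt0 ?expR_gt0.
have uE : r ^+ 2 / be = r ^+ 2 * expR (- 2 * m) / b0.
  by rewrite /be mulNr expRN; field; rewrite !gt_eqF ?expR_gt0.
pose a := A * expR m.
have a0 : 0 < a by rewrite mulr_gt0 ?expR_gt0.
have := @shell_integral (a * c0) (a * c1) be x (mulr_ge0 (ltW a0) c00) (mulr_ge0 (ltW a0) c10) be0 x0.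
cbv zeta; rewrite -/r uE yE => Ir.
rewrite integral_mkcond -[RHS](_ : (mom0 R * mom1 R * (pow32 be * y ^+ 2 * (6 * (a * c0) + a * c1 * y)) / r ^+ 8)%:E = _)%E.
  rewrite -Ir; apply: eq_integral => v _; rewrite patchE; case: ifPn => vnz.
    by rewrite FE; [congr EFin; rewrite /a; ring|move: vnz; rewrite inE].
  (* Outside [nz3] only the origin remains, where [pow32] vanishes, so both domains give the same
     integral. *)
  have -> : v = 0 by apply/eqP; apply: contraNT vnz => v0; rewrite inE.
  have -> : @angmom2 x 0 - be * dot3 0 0 = 0 by rewrite /angmom2 !dot3E /=; ring.
  by rewrite pow32_le0// mulr0 mul0r.
congr EFin.
have [y0|yn0] := eqVneq y 0; first by rewrite y0 expr0n /= !(mulr0, mul0r).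
have yp : 0 < y.
  by rewrite lt_neqAle eq_sym yn0 -yE le_max lexx orbT.
have r2E : r ^+ 2 = be * (1 + y).
  have : r ^+ 2 * expR (- 2 * m) / b0 - 1 = y.
    by move: yp; rewrite -yE lt_max ltxx orbF => /ltW/max_l.
  by rewrite -uE => <-; field; rewrite gt_eqF.
have bE : Num.sqrt b0 ^+ 2 = b0 by rewrite sqr_sqrtr// ltW.
have sb0 : 0 < Num.sqrt b0 by rewrite sqrtr_gt0.
have em : expR (2 * m) = expR m ^+ 2 by rewrite expRM_natl.
(* Here the factor E of the ansatz pays off: the be^2 cancels against r^8 = be^2 (1 + y)^2 r^4, and
   m survives only through y. *)
have p32 : expR m * pow32 be = be ^+ 2 / Num.sqrt b0.
  rewrite /pow32 {2}/be em sqrtrM ?(ltW b00)// sqrtr_sqr ger0_norm ?expR_ge0//.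
  by rewrite /be em -{1 3}bE; field; rewrite gt_eqF.
have -> : mom0 R * mom1 R * (pow32 be * y ^+ 2 * (6 * (a * c0) + a * c1 * y)) / r ^+ 8 =
  mom0 R * mom1 R * (expR m * pow32 be * y ^+ 2 * A * (6 * c0 + c1 * y)) / r ^+ 8.
  by rewrite /a; ring.
have -> : r ^+ 8 = be ^+ 2 * (1 + y) ^+ 2 * r ^+ 4.
  by rewrite -exprMn -r2E; ring.
by rewrite p32; field; rewrite !gt_eqF// ?addr_gt0.
Qed.
End matter.

(** * The Vlasov equation *)

Section lines.
Variable R : realType.
Implicit Types (x v : R3 R) (a : 'I_3).

Lemma is_derive_line (f : R3 R -> R) x e (d : R) :
  is_derive (0 : R) 1 (fun h : R => f (h *: e + x)) d -> is_derive x e f d.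
Proof.
move=> [df dfE].
have E : (fun h : R => h^-1 *: (((fun h : R => f (h *: e + x)) \o shift 0) (h *: 1) - f (0 *: e + x))) =
         (fun h : R => h^-1 *: ((f \o shift x) (h *: e) - f x)).
  by apply/funext => h /=; rewrite scale0r add0r addr0 /GRing.scale /= mulr1.
split; first by move: df; rewrite /derivable E.
by move: dfE; rewrite /derive E.
Qed.

Lemma line3E (h : R) (e x : R3 R) :
  h *: e + x = ((h * e.1.1 + x.1.1, h * e.1.2 + x.1.2), h * e.2 + x.2).
Proof. by []. Qed.

Lemma dot3_line x v a (h : R) : dot3 (h *: ebasis R a + x) v = dot3 x v + h * coord3 v a.
Proof.
by case: a => [[|[|[|//]]] ?]; rewrite line3E !dot3E /coord3 /ebasis /=; ring.
Qed.

Lemma dot3C x v : dot3 x v = dot3 v x.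
Proof. by rewrite !dot3E; ring. Qed.

Lemma coord3_line x a (h : R) : coord3 (h *: ebasis R a + x) a = coord3 x a + h.
Proof. by case: a => [[|[|[|//]]] ?]; rewrite line3E /coord3 /ebasis /=; ring. Qed.

Lemma is_derive_dot3_line x v a :
  is_derive (0 : R) 1 (fun h : R => dot3 (h *: ebasis R a + x) v) (coord3 v a).
Proof.
under eq_fun do rewrite dot3_line.
by apply: is_derive_eq; rewrite /GRing.scale /=; ring.
Qed.

Lemma is_derive_dot3_line2 x a :
  is_derive (0 : R) 1 (fun h : R => dot3 (h *: ebasis R a + x) (h *: ebasis R a + x))
    (2 * coord3 x a).
Proof.
under eq_fun do rewrite dot3_line dot3C dot3_line coord3_line.
by apply: is_derive_eq; rewrite /GRing.scale /=; ring.
Qed.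

Lemma is_derive_enorm3_line x a : x != 0 ->
  is_derive (0 : R) 1 (fun h : R => enorm3 (h *: ebasis R a + x)) (coord3 x a / enorm3 x).
Proof.
move=> x0; have d1 := is_derive_dot3_line2 x a.
have p0 : 0 < dot3 (0 *: ebasis R a + x) (0 *: ebasis R a + x).
  by rewrite scale0r add0r dot3_gt0.
have d2 := is_derive1_sqrt p0.
have d3 := @is_derive1_comp _ (@Num.sqrt R) _ 0 _ _ d2 d1.
apply: is_derive_eq d3 _; rewrite scale0r add0r -/(enorm3 x).
by field; rewrite gt_eqF// enorm3_gt0.
Qed.

Lemma is_derive_angmom2_linel x v a :
  is_derive (0 : R) 1 (fun h : R => angmom2 (h *: ebasis R a + x) v)
    (2 * coord3 x a * dot3 v v - 2 * dot3 x v * coord3 v a).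
Proof.
have d1 := is_derive_dot3_line2 x a; have d2 := is_derive_dot3_line x v a.
rewrite /angmom2; apply: is_derive_eq; rewrite scale0r add0r /GRing.scale /=; ring.
Qed.

Lemma angmom2C x v : angmom2 x v = angmom2 v x.
Proof. by rewrite /angmom2 dot3C mulrC. Qed.

End lines.

Section vlasov.
Variables (R : realType) (A b0 : R).
Implicit Types (x v : R3 R) (a : 'I_3).

Definition ansatz (E L : R) : R := A * E * pow32 (L - b0 * E ^+ 2) * expR (- (2 * L)).

Definition ansatz_dE (E L : R) : R :=
  A * (pow32 (L - b0 * E ^+ 2) - 3 * b0 * E ^+ 2 * Num.sqrt (L - b0 * E ^+ 2)) * expR (- (2 * L)).

Definition ansatz_dL (E L : R) : R :=
  A * E * (3 / 2 * Num.sqrt (L - b0 * E ^+ 2) - 2 * pow32 (L - b0 * E ^+ 2)) * expR (- (2 * L)).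

Lemma is_derive_ansatz (E L : R -> R) (h dE dL : R) :
  is_derive h 1 E dE -> is_derive h 1 L dL ->
  is_derive h 1 (fun t => ansatz (E t) (L t))
    (ansatz_dE (E h) (L h) * dE + ansatz_dL (E h) (L h) * dL).
Proof.
move=> d1 d2.
have d3 : is_derive h 1 (fun t => L t - b0 * E t ^+ 2) (dL - 2 * b0 * E h * dE).
  by apply: is_derive_eq; rewrite /GRing.scale /=; ring.
have d4 := @is_derive1_comp _ (@pow32 R) _ h _ _ (is_derive_pow32 _) d3.
have d5 : is_derive h 1 (fun t => - (2 * L t)) (- (2 * dL)).
  by apply: is_derive_eq; rewrite /GRing.scale /=; ring.
have d6 := @is_derive1_comp _ (@expR R) _ h _ _ (is_derive_expR _) d5.
rewrite /ansatz; apply: is_derive_eq; rewrite /GRing.scale /= /ansatz_dE /ansatz_dL.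
by field.
Qed.

Variable mu : R -> R.

Definition photon_density x v : R :=
  ansatz (expR (mu (enorm3 x)) * enorm3 v) (angmom2 x v).

Hypothesis dmu : forall r : R, 0 < r -> derivable mu r 1.

Lemma is_derive_photon_density_x x v a : x != 0 ->
  is_derive (0 : R) 1 (fun h : R => photon_density (h *: ebasis R a + x) v)
   (ansatz_dE (expR (mu (enorm3 x)) * enorm3 v) (angmom2 x v) *
     (expR (mu (enorm3 x)) * enorm3 v * derive1 mu (enorm3 x) * (coord3 x a / enorm3 x)) +
    ansatz_dL (expR (mu (enorm3 x)) * enorm3 v) (angmom2 x v) *
     (2 * coord3 x a * dot3 v v - 2 * dot3 x v * coord3 v a)).
Proof.
move=> x0.
have d1 := is_derive_enorm3_line a x0.
have d2 : is_derive (enorm3 x) 1 mu (derive1 mu (enorm3 x)).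
  by rewrite derive1E; apply: DeriveDef => //; exact/dmu/enorm3_gt0.
have E0 : enorm3 (0 *: ebasis R a + x) = enorm3 x by rewrite scale0r add0r.
rewrite -[in X in is_derive X _ mu]E0 in d2.
have d3 := @is_derive1_comp _ mu _ 0 _ _ d2 d1.
have d4 : is_derive (0 : R) 1 (fun h : R => expR (mu (enorm3 (h *: ebasis R a + x))))
    (expR (mu (enorm3 (0 *: ebasis R a + x))) * (derive1 mu (enorm3 x) * (coord3 x a / enorm3 x))).
  exact: (@is_derive1_comp _ (@expR R) _ 0 _ _ (is_derive_expR _) d3).
have d5 : is_derive (0 : R) 1 (fun h => expR (mu (enorm3 (h *: ebasis R a + x))) * enorm3 v)
   (expR (mu (enorm3 x)) * enorm3 v * derive1 mu (enorm3 x) * (coord3 x a / enorm3 x)).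
  by apply: is_derive_eq; rewrite E0 /GRing.scale /=; ring.
have d6 := is_derive_ansatz d5 (is_derive_angmom2_linel x v a).
by apply: is_derive_eq d6 _; rewrite scale0r add0r.
Qed.

Lemma is_derive_photon_density_v x v a : v != 0 ->
  is_derive (0 : R) 1 (fun h : R => photon_density x (h *: ebasis R a + v))
   (ansatz_dE (expR (mu (enorm3 x)) * enorm3 v) (angmom2 x v) *
     (expR (mu (enorm3 x)) * (coord3 v a / enorm3 v)) +
    ansatz_dL (expR (mu (enorm3 x)) * enorm3 v) (angmom2 x v) *
     (2 * coord3 v a * dot3 x x - 2 * dot3 x v * coord3 x a)).
Proof.
move=> v0.
have d1 := is_derive_enorm3_line a v0.
have d5 : is_derive (0 : R) 1 (fun h => expR (mu (enorm3 x)) * enorm3 (h *: ebasis R a + v))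
   (expR (mu (enorm3 x)) * (coord3 v a / enorm3 v)).
  by apply: is_derive_eq; rewrite /GRing.scale /=; ring.
have d6 := is_derive_ansatz d5 (is_derive_angmom2_linel v x a).
rewrite /photon_density; under eq_fun do rewrite angmom2C.
by apply: is_derive_eq d6 _; rewrite scale0r add0r (dot3C v x) (angmom2C v x).
Qed.

(** Conservation of E and L along the flow: the E-terms on both sides are the same multiple of the
    dot product of x and v, and the L-terms sum to zero on each side separately. *)
Lemma vlasov_cancel x v : x != 0 -> v != 0 ->
  (enorm3 v)^-1 * \sum_(a < 3) coord3 v a *
    (ansatz_dE (expR (mu (enorm3 x)) * enorm3 v) (angmom2 x v) *
     (expR (mu (enorm3 x)) * enorm3 v * derive1 mu (enorm3 x) * (coord3 x a / enorm3 x)) +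
    ansatz_dL (expR (mu (enorm3 x)) * enorm3 v) (angmom2 x v) *
     (2 * coord3 x a * dot3 v v - 2 * dot3 x v * coord3 v a)) =
  \sum_(a < 3) coord3 x a / enorm3 x * enorm3 v * derive1 mu (enorm3 x) *
    (ansatz_dE (expR (mu (enorm3 x)) * enorm3 v) (angmom2 x v) *
     (expR (mu (enorm3 x)) * (coord3 v a / enorm3 v)) +
    ansatz_dL (expR (mu (enorm3 x)) * enorm3 v) (angmom2 x v) *
     (2 * coord3 v a * dot3 x x - 2 * dot3 x v * coord3 x a)).
Proof.
move=> x0 v0; have nx := enorm3_gt0 x0; have nv := enorm3_gt0 v0.
move: (enorm3 x) (enorm3 v) nx nv => r n r0 n0.
rewrite !dot3E.
set GE := ansatz_dE _ _; set GL := ansatz_dL _ _; set E := expR _; set m := derive1 _ _.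
rewrite !big_ord_recl !big_ord0 /coord3 /=.
by field; rewrite !gt_eqF.
Qed.
End vlasov.

Section shell_density.
Variables (R : realType) (A b0 R1 R2 : R) (Y mu : R -> R).
Implicit Types (x v : R3 R) (a : 'I_3).

(** For the shell metric r^2 e^(-2 mu) exceeds b0 again far out, and the cut-off removes the photons
    that the ansatz would place there. *)
Definition shell_density x v : R :=
  if enorm3 x < R1 then photon_density A b0 mu x v else 0.

Lemma rot3_coord (M : 'M[R]_3) x (i : 'I_3) :
  coord3 (rot3 M x) i = \sum_(j < 3) M i j * coord3 x j.
Proof.
case: i => [[|[|[|//]]] i3]; rewrite /coord3 /rot3 /=; apply: eq_bigr => j _;
  congr (M _ _ * _); apply/val_inj; by rewrite /= inordK.
Qed.

Lemma dot3_rot3 (M : 'M[R]_3) x v : SO3 M -> dot3 (rot3 M x) (rot3 M v) = dot3 x v.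
Proof.
move=> [MM _]; rewrite /dot3.
transitivity (\sum_(j < 3) \sum_(k < 3) (M^T *m M) j k * (coord3 x j * coord3 v k)).
  transitivity (\sum_(a < 3) \sum_(j < 3) \sum_(k < 3) M a j * M a k * (coord3 x j * coord3 v k)).
    apply: eq_bigr => a _; rewrite !rot3_coord mulr_suml; apply: eq_bigr => j _.
    by rewrite mulr_sumr; apply: eq_bigr => k _; ring.
  rewrite exchange_big; apply: eq_bigr => j _.
  rewrite exchange_big; apply: eq_bigr => k _.
  rewrite mxE mulr_suml; apply: eq_bigr => a _.
  by rewrite mxE.
rewrite MM; apply: eq_bigr => j _; rewrite (bigD1 j)//= big1 => [|k kj].
  by rewrite mxE eqxx addr0 mul1r.
by rewrite mxE eq_sym (negbTE kj) mul0r.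
Qed.

Lemma shell_density_rot3 (M : 'M[R]_3) x v : SO3 M ->
  shell_density (rot3 M x) (rot3 M v) = shell_density x v.
Proof.
by move=> SM; rewrite /shell_density /photon_density /angmom2 /enorm3 !dot3_rot3.
Qed.

Lemma shell_density_ge0 x v : 0 <= A -> 0 <= shell_density x v.
Proof.
move=> A0; rewrite /shell_density; case: ifP => // _; rewrite /photon_density /ansatz.
apply: mulr_ge0; last exact: expR_ge0.
apply: mulr_ge0; last exact: pow32_ge0.
by rewrite !mulr_ge0 ?expR_ge0// sqrtr_ge0.
Qed.

Hypotheses (b00 : 0 < b0) (R10 : 0 < R1) (R12 : R1 < R2).
Hypothesis Y0 : forall r, R1 <= r -> Y r = 0.
Hypothesis muY : forall r : R, 0 < r < R2 ->
  Num.max (r ^+ 2 * expR (- 2 * mu r) / b0 - 1) 0 = Y r.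
Hypothesis dmu : forall r : R, 0 < r -> derivable mu r 1.

(** Between R1 and R2 one has L <= r^2 |v|^2 <= b0 E^2, so the ansatz already vanishes there. *)
Lemma shell_densityE x v : enorm3 x < R2 -> shell_density x v = photon_density A b0 mu x v.
Proof.
rewrite /shell_density => xR2; have [//|xR1] := ltP (enorm3 x) R1.
rewrite /photon_density /ansatz pow32_le0 ?mulr0 ?mul0r//.
have x0 := lt_le_trans R10 xR1.
have : enorm3 x ^+ 2 * expR (- 2 * mu (enorm3 x)) / b0 - 1 <= 0.
  by rewrite -[leRHS](Y0 xR1) -muY ?x0// le_max lexx.
rewrite subr_le0 ler_pdivrMr// mul1r mulNr expRN ler_pdivrMr ?expR_gt0// => xb.
rewrite exprMn -expRM_natl enorm3_sqr subr_le0 /angmom2.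
apply: (@le_trans _ _ (enorm3 x ^+ 2 * dot3 v v)).
  by rewrite enorm3_sqr gerBl sqr_ge0.
by rewrite mulrA ler_wpM2r ?dot3_ge0.
Qed.

(** Splitting at R2 instead of R1 gives overlapping open regions: near x the density is either the
    smooth ansatz or zero, and no junction has to be differentiated. *)
Lemma is_derive_shell_density_x x v a : x != 0 ->
  is_derive x (ebasis R a) (fun z => shell_density z v)
   (if enorm3 x < R2 then ansatz_dE A b0 (expR (mu (enorm3 x)) * enorm3 v) (angmom2 x v) *
     (expR (mu (enorm3 x)) * enorm3 v * derive1 mu (enorm3 x) * (coord3 x a / enorm3 x)) +
    ansatz_dL A b0 (expR (mu (enorm3 x)) * enorm3 v) (angmom2 x v) *
     (2 * coord3 x a * dot3 v v - 2 * dot3 x v * coord3 v a) else 0).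
Proof.
move=> x0; apply: is_derive_line.
have cn : {for (0 : R), continuous (fun h : R => enorm3 (h *: ebasis R a + x))}.
  have [dn _] := is_derive_enorm3_line a x0.
  exact/differentiable_continuous/derivable1_diffP.
have E0 : enorm3 (0 *: ebasis R a + x) = enorm3 x by rewrite scale0r add0r.
case: ifPn => [xR|]; last rewrite -leNgt => xR.
  apply: near_eq_is_derive (is_derive_photon_density_x A b0 dmu v a x0).
  near=> h; rewrite shell_densityE//; near: h.
  by apply: (cvgr_lt _ cn); rewrite E0.
apply: (@near_eq_is_derive _ _ _ (fun=> 0)).
near=> h; rewrite /shell_density ltNge ltW//; near: h.
by apply: (cvgr_gt _ cn); rewrite E0; exact: lt_le_trans xR.
Unshelve. all: by end_near. Qed.

Lemma is_derive_shell_density_v x v a : v != 0 ->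
  is_derive v (ebasis R a) (shell_density x)
   (if enorm3 x < R2 then ansatz_dE A b0 (expR (mu (enorm3 x)) * enorm3 v) (angmom2 x v) *
     (expR (mu (enorm3 x)) * (coord3 v a / enorm3 v)) +
    ansatz_dL A b0 (expR (mu (enorm3 x)) * enorm3 v) (angmom2 x v) *
     (2 * coord3 v a * dot3 x x - 2 * dot3 x v * coord3 x a) else 0).
Proof.
move=> v0; apply: is_derive_line.
case: ifPn => [xR|]; last rewrite -leNgt => xR.
  under eq_fun do rewrite shell_densityE//.
  exact: is_derive_photon_density_v.
rewrite (_ : (fun h : R => _) = (fun=> 0)); last first.
  by apply/funext => h; rewrite /shell_density ltNge (le_trans _ xR)// ltW.
exact: is_derive_cst.
Qed.

Lemma shell_density_vlasov x v (c : R) : x != 0 -> v != 0 ->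
  c / enorm3 v * (\sum_(a < 3) coord3 v a * ('D_(ebasis R a) (fun y => shell_density y v) x))
  - c * (\sum_(a < 3) coord3 x a / enorm3 x * enorm3 v * derive1 mu (enorm3 x)
                         * ('D_(ebasis R a) (shell_density x) v)) = 0.
Proof.
move=> x0 v0.
have dx a := @derive_val _ _ _ _ _ _ _ (is_derive_shell_density_x v a x0).
have dv a := @derive_val _ _ _ _ _ _ _ (is_derive_shell_density_v x a v0).
under eq_bigr do rewrite dx.
under [X in _ - _ * X]eq_bigr do rewrite dv.
case: (enorm3 x < R2); last first.
  by rewrite !big1 ?mulr0 ?subr0// => a _; rewrite mulr0.
by rewrite -mulrA vlasov_cancel// subrr.
Qed.
End shell_density.

(** * The Hawking mass *)

Section mass.
Variables (R : realType) (C : R) (Y lam : R -> R).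
Hypotheses (cY : continuous Y) (Y_ge0 : forall r, 0 <= Y r).
Hypothesis Y1 : forall r, r <= 1 -> Y r = 0.
Hypothesis dlam : forall r : R, derivable lam r 1.
Hypothesis einstein : forall r : R, 0 < r ->
  expR (- 2 * lam r) * (2 * r * derive1 lam r - 1) + 1 = rhohat C (Y r) r.

(** The first Einstein equation says that r (1 - e^(-2 lambda)) / 2 has derivative 4 pi r^2 rho, and
    this function vanishes at 0. *)
Lemma hawking_massE (r : R) : 0 < r ->
  hawking_mass (fun s => rhohat C (Y s) s / (8 * pi * s ^+ 2)) r =
  (r / 2 * (1 - expR (- 2 * lam r)))%:E.
Proof.
move=> r0; rewrite /hawking_mass; move: pi (@pi_gt0 R) => q q0.
(* Replacing s by max(s, 1) in the denominator keeps the integrand, as Y vanishes for s <= 1, and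
   makes it continuous at 0. *)
pose g s := C * Y s ^+ 2 * (Y s + 6) / ((1 + Y s) ^+ 2 * Num.max s 1 ^+ 2) / (8 * q).
pose G s := s / 2 * (1 - expR (- 2 * lam s)) / (4 * q).
have Yp s : 0 < 1 + Y s by rewrite ltr_wpDr.
have m0 s : 0 < Num.max s 1 :> R by rewrite lt_max ltr01 orbT.
have gE s : s ^+ 2 * (rhohat C (Y s) s / (8 * q * s ^+ 2)) = g s.
  rewrite /g /rhohat; have [s1|s1] := leP s 1.
    by rewrite Y1// expr0n /= !(mulr0, mul0r).
  have s0 : 0 < s by exact: lt_trans s1.
  by field; rewrite !gt_eqF.
have cg : continuous g.
  move=> s; have cYs : Y z @[z --> s] --> Y s by exact: cY.
  have csq (u : R -> R) (l : R) : u z @[z --> s] --> l -> u z ^+ 2 @[z --> s] --> l ^+ 2.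
    by move=> ul; exact: (cvgM ul ul).
  have cmax : Num.max z 1 @[z --> s] --> Num.max s 1.
    by apply: continuous_max; [exact: cvg_id|exact: cvg_cst].
  apply: cvgM; last exact: cvg_cst.
  apply: cvgM.
    apply: cvgM; last by apply: cvgD => //; exact: cvg_cst.
    by apply: cvgM; [exact: cvg_cst|exact: csq].
  apply: cvgV; first by rewrite mulf_neq0// expf_neq0// gt_eqF.
  by apply: cvgM; apply: csq => //; apply: cvgD => //; exact: cvg_cst.
have dG (s : R) : is_derive s 1 G ((1 - expR (- 2 * lam s) + 2 * s * derive1 lam s * expR (- 2 * lam s)) / (8 * q)).
  have d1 : is_derive s 1 lam (derive1 lam s) by rewrite derive1E; exact: DeriveDef.
  have d2 : is_derive s 1 (fun s => - 2 * lam s) (- 2 * derive1 lam s).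
    by apply: is_derive_eq; rewrite /GRing.scale /=; ring.
  have d3 : is_derive s 1 (fun s => expR (- 2 * lam s)) (expR (- 2 * lam s) * (- 2 * derive1 lam s)).
    exact: (@is_derive1_comp _ (@expR R) _ s _ _ (is_derive_expR _) d2).
  rewrite /G; apply: is_derive_eq; rewrite /GRing.scale /=.
  by field; rewrite gt_eqF.
have cG : continuous G.
  by move=> s; apply/differentiable_continuous/derivable1_diffP; have [] := dG s.
have I : (\int[@lebesgue_measure R]_(s in `[0%R, r]) (g s)%:E)%E = (G r - G 0)%:E.
  rewrite EFinB; apply: continuous_FTC2 => //.
  - exact: continuous_subspaceT.
  - split=> [x _||].
    + by have [] := dG x.
    + by apply: cvg_at_right_filter; exact: cG.
    + by apply: cvg_at_left_filter; exact: cG.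
  - move=> x; rewrite in_itv /= => /andP[x0 _].
    rewrite derive1E (@derive_val _ _ _ _ _ _ _ (dG x)) -gE -einstein//.
    by field; rewrite !gt_eqF.
under eq_integral do rewrite gE.
rewrite I -EFinM /G; congr EFin.
by field; rewrite gt_eqF.
Qed.
End mass.

Theorem theorem1 (R : realType) :
  exists (mu lam : R -> R) (f : R3 R -> R3 R -> R) (rho p pT : R -> R),
    (* f >= 0 on R^3 x (R^3 \ {0}) *)
    (forall x v, v != 0 -> 0 <= f x v) /\
    (* spherical symmetry *)
    (forall (A : 'M[R]_3) x v, SO3 A -> v != 0 -> f (rot3 A x) (rot3 A v) = f x v) /\
    (* matter quantities (as functions of r = |x|) *)
    (forall x, x != 0 ->
       (\int[@leb3 R]_(v in @nz3 R) (f x v * enorm3 v)%:E)%E = (rho (enorm3 x))%:E /\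
       (\int[@leb3 R]_(v in @nz3 R)
           (f x v / enorm3 v * (dot3 x v / enorm3 x) ^+ 2)%:E)%E = (p (enorm3 x))%:E /\
       (\int[@leb3 R]_(v in @nz3 R)
           (2^-1 * enorm3 (scale3 (enorm3 x)^-1 (cross3 x v)) ^+ 2 * f x v / enorm3 v)%:E)%E
         = (pT (enorm3 x))%:E) /\
    (* regularity of the metric functions *)
    {within `[0, +oo[, continuous mu} /\ {within `[0, +oo[, continuous lam} /\
    (forall r, 0 < r -> derivable mu r 1 /\ derivable lam r 1) /\
    (* Einstein equations *)
    (forall r, 0 < r ->
       expR (- 2 * lam r) * (2 * r * derive1 lam r - 1) + 1 = 8 * pi * r ^+ 2 * rho r /\
       expR (- 2 * lam r) * (2 * r * derive1 mu r + 1) - 1 = 8 * pi * r ^+ 2 * p r) /\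
    (* regular center *)
    lam 0 = 0 /\
    (* asymptotic flatness *)
    (mu r @[r --> +oo] --> 0) /\ (lam r @[r --> +oo] --> 0) /\
    (* static Vlasov equation (classical sense) *)
    (forall x v, x != 0 -> v != 0 ->
       (forall a, derivable (fun y => f y v) x (@ebasis R a)) /\
       (forall a, derivable (f x) v (@ebasis R a)) /\
       expR (mu (enorm3 x) - lam (enorm3 x)) / enorm3 v *
         (\sum_(a < 3) coord3 v a * ('D_(@ebasis R a) (fun y => f y v) x))
       - expR (mu (enorm3 x) - lam (enorm3 x)) *
         (\sum_(a < 3) coord3 x a / enorm3 x * enorm3 v * derive1 mu (enorm3 x)
                         * ('D_(@ebasis R a) (f x) v)) = 0) /\
    (* compactly supported matter quantities *)
    (exists R0 : R, forall r, R0 <= r -> rho r = 0 /\ p r = 0 /\ pT r = 0) /\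
    (* compactness bound 4/5 < sup_r 2m(r)/r < 8/9 *)
    ((4 / 5)%:E < ereal_sup [set ((2 / r)%:E * hawking_mass rho r)%E | r in `]0%R, +oo[%classic]
     /\ ereal_sup [set ((2 / r)%:E * hawking_mass rho r)%E | r in `]0%R, +oo[%classic] < (8 / 9)%:E)%E.
Proof.
have [C [b0 [R1 [R2 [Y [mu [lam [[C0 b00 R10 R12] [cY Y_ge0 Y0] muY]]]]]]]] := @photon_shell_metric R.
move=> [dml cmu clam ein] [lam0 limmu limlam lo [B B89 hi]].
have p0 : 0 < pi :> R by exact: pi_gt0.
have m00 := mom0_gt0 R; have m10 := mom1_gt0 R.
have YR1 r : R1 <= r -> Y r = 0 by move=> ?; apply: Y0; right.
have sb0 : 0 < Num.sqrt b0 by rewrite sqrtr_gt0.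
(* Chosen so that the prefactor in [momentum_integral] becomes C / (8 pi). *)
pose A := C * Num.sqrt b0 / (8 * pi * (mom0 R * mom1 R)).
have A0 : 0 < A by rewrite divr_gt0// !mulr_gt0.
have dmu (r : R) : 0 < r -> derivable mu r 1 by move=> _; have [] := dml r.
pose rho s := rhohat C (Y s) s / (8 * pi * s ^+ 2).
pose p s := qhat C (Y s) s / (8 * pi * s ^+ 2).
pose f := shell_density A b0 R1 mu.
(* c0 and c1 weight the transverse and radial parts of |v|^2: (1, 1) yields rho, (0, 1) yields p and
   (1/2, 0) yields p_T. *)
have matter c0 c1 (x : R3 R) (F : R3 R -> R) (q : R) : 0 <= c0 -> 0 <= c1 -> x != 0 ->
  (forall v, v != 0 -> F v = f x v / enorm3 v *
     (c0 * (dot3 v v - (dot3 x v / enorm3 x) ^+ 2) + c1 * (dot3 x v / enorm3 x) ^+ 2)) ->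
  q = C / (8 * pi) * (Y (enorm3 x) ^+ 2 * (6 * c0 + c1 * Y (enorm3 x)) / (1 + Y (enorm3 x)) ^+ 2) / enorm3 x ^+ 4 ->
  (\int[@leb3 R]_(v in @nz3 R) (F v)%:E)%E = q%:E.
  move=> c00 c10 x0 FE ->; have [xR1|xR1] := ltP (enorm3 x) R1.
    rewrite (@momentum_integral R A b0 (mu (enorm3 x)) c0 c1 (Y (enorm3 x)) x)//.
    - congr EFin; congr (_ * _ / _); rewrite /A; move: pi p0 => q' q0; field.
      by rewrite !gt_eqF.
    - by apply: muY; rewrite enorm3_gt0//=; exact: lt_trans R12.
    - move=> v v0; rewrite FE// /f /shell_density xR1 /photon_density /ansatz.
      rewrite exprMn enorm3_sqr -expRM_natl (mulrA b0).
      by field; rewrite !gt_eqF ?enorm3_gt0.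
  rewrite YR1// expr0n /= !(mulr0, mul0r); apply: integral0_eq => v.
  by move=> v0; rewrite FE// /f /shell_density ltNge xR1 /= !mul0r.
(* The tangential pressure is dictated by the vanishing trace, rho = p + 2 p_T. *)
exists mu, lam, f, rho, p, (fun s => (rho s - p s) / 2).
have hm r : 0 < r -> ((2 / r)%:E * hawking_mass rho r)%E = (1 - expR (- 2 * lam r))%:E.
  have Y1 s : s <= 1 -> Y s = 0 by move=> s1; apply: Y0; left.
  have dlam s : derivable lam s 1 by have [] := dml s.
  have elam (s : R) : 0 < s ->
      expR (- 2 * lam s) * (2 * s * derive1 lam s - 1) + 1 = rhohat C (Y s) s.
    by move=> s0; have [] := ein s s0.
  move=> r0; rewrite (hawking_massE cY Y_ge0 Y1 dlam elam r0) -EFinM; congr EFin.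
  by field; rewrite gt_eqF.
split; first by move=> x v _; apply: shell_density_ge0; exact: ltW.
split; first by move=> M x v SM _; exact: shell_density_rot3.
split.
  move=> x x0; have r0 := enorm3_gt0 x0.
  have Yx : 0 < 1 + Y (enorm3 x) by rewrite ltr_wpDr.
  split; last split.
  - apply: (matter 1 1 x _ _ ler01 ler01 x0).
      by move=> v v0; rewrite !mul1r subrK -enorm3_sqr; field; rewrite gt_eqF// enorm3_gt0.
    by rewrite /rho /rhohat; move: pi p0 => q q0; field; rewrite !gt_eqF.
  - apply: (matter 0 1 x _ _ (lexx 0) ler01 x0).
      by move=> v v0; rewrite mul0r mul1r add0r.
    by rewrite /p /qhat; move: pi p0 => q q0; field; rewrite !gt_eqF.
  - have half0 : 0 <= 2^-1 :> R by rewrite invr_ge0.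
    apply: (matter 2^-1 0 x _ _ half0 (lexx 0) x0).
      move=> v v0; rewrite enorm3_cross /angmom2 -(enorm3_sqr x).
      by field; rewrite !gt_eqF ?enorm3_gt0.
    by rewrite /p /rho /rhohat /qhat; move: pi p0 => q q0; field; rewrite !gt_eqF.
split; first exact: continuous_subspaceT.
split; first exact: continuous_subspaceT.
split; first by move=> r _; exact: dml.
split.
  move=> r r0; have [-> ->] := ein r r0; rewrite /rho /p.
  by move: pi p0 => q q0; split; field; rewrite !gt_eqF.
split; first exact: lam0.
split; first exact: limmu.
split; first exact: limlam.
split.
  move=> x v x0 v0; split; last split.
  - by move=> a; have [] := is_derive_shell_density_x A b00 R10 R12 YR1 muY dmu v a x0.
  - by move=> a; have [] := is_derive_shell_density_v A b00 R10 R12 YR1 muY x a v0.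
  - exact: (shell_density_vlasov A b00 R10 R12 YR1 muY dmu).
split.
  exists R1 => r rR; rewrite /rho /p /rhohat /qhat YR1// !expr0n /= !(mulr0, mul0r).
  by rewrite subr0 mul0r.
split.
  apply: (@lt_le_trans _ _ (1 - expR (- 2 * lam R1))%:E); first by rewrite lte_fin.
  rewrite -hm//; apply: ereal_sup_ubound; exists R1 => //.
  by rewrite /= in_itv /= R10.
apply: (@le_lt_trans _ _ B%:E); last by rewrite lte_fin.
apply: ge_ereal_sup => _ [r /= + <-]; rewrite in_itv /= andbT => r0.
by rewrite hm// lee_fin hi.
Qed.
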